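(* Let $N\ge 3$, let $a\in\mathbb{R}$ satisfy $N-2+a>0$, and let $f:(\mathbb{R}^N\setminus\{0\})\times[0,\infty)\to\mathbb{R}$ be an admissible nonlinearity (as defined in the context). Assume that: (i) for every $(x,y)\in(\mathbb{R}^N\setminus\{0\})\times(0,\infty)$ the map $$\mu\longmapsto \mu^{\frac{N+2-a}{N-2+a}}\,f\big(\mu^{\frac{2}{N-2+a}}x,\ \mu^{-1}y\big)\quad\text{is strictly increasing on } [1,\infty);$$ (ii) there exist $d>0$, $b>a-2$ and $p$ with $1<p<p_S(a,b):=\frac{N+2+2b-a}{N-2+a}$ such that for all sufficiently large $R>1$, $$f(x,y)\ge d\,|x|^{b}y^{p}\quad\text{for all }(x,y)\in B_R^c(0)\times[0,\infty).$$ Then the equation $-\operatorname{div}(|x|^{a}Du)=f(x,u)$ in $\mathbb{R}^N$ has no positive solution.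
   Context: $Du$ denotes the gradient of $u$, and $B_R^c(0)=\mathbb{R}^N\setminus B_R(0)$ is the complement of the open ball of radius $R$ centered at the origin. A function $f:(\mathbb{R}^N\setminus\{0\})\times[0,\infty)\to\mathbb{R}$ is called admissible if it is smooth and: (I) $f(x,0)=0$ and $f(x,u)>0$ for all $x\ne 0$, $u>0$; (II) $0\le u\le v$ implies $f(x,u)\le f(x,v)$ for all $x\neq 0$; (III) there is $b_0>a-2>-N$ such that for each compact $\omega\subset[0,\infty)$ there exists $L>0$ with $|f(x,u)-f(x,v)|\le L|x|^{b_0}|u-v|$ for all $x\ne0$ and $u,v\in\omega$. A positive solution in $\mathbb{R}^N$ is a function $u:\mathbb{R}^N\to(0,\infty)$ of class $C^2(\mathbb{R}^N\setminus\{0\})\cap C(\mathbb{R}^N)$ satisfying the equation pointwise everywhere in $\mathbb{R}^N\setminus\{0\}$. *)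

(* Defs.v *)
From HB Require Import structures.
From mathcomp Require Import all_boot all_order all_algebra.
From mathcomp Require Import all_classical all_reals all_analysis.

Set Implicit Arguments.
Unset Strict Implicit.
Unset Printing Implicit Defensive.

Import Order.TTheory GRing.Theory Num.Theory.
Import numFieldNormedType.Exports.

Local Open Scope classical_set_scope.
Local Open Scope ring_scope.

(* The library norm on ['rV[R]_N] is the sup norm; it induces the usual
   topology, but the weights and balls below need the Euclidean norm. *)
Definition enorm (R : realType) (N : nat) (x : 'rV[R]_N) : R :=
  Num.sqrt (\sum_(i < N) x 0 i ^+ 2).

Definition gradient (R : realType) (N : nat) (u : 'rV[R]_N -> R)
    (x : 'rV[R]_N) : 'rV[R]_N :=
  \row_(i < N) 'D_(delta_mx 0 i) u x.

Definition divergence (R : realType) (N : nat) (F : 'rV[R]_N -> 'rV[R]_N)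
    (x : 'rV[R]_N) : R :=
  \sum_(i < N) 'D_(delta_mx 0 i) (fun z => F z 0 i) x.

(* Class C^k on an open set [W]. In finite dimension, which is the only case
   used here, [x |-> 'd f x] is C^k iff [x |-> 'D_v f x] is for every [v]. *)
Fixpoint classC (R : realType) (V : normedModType R) (k : nat) (W : set V)
    (f : V -> R) : Prop :=
  match k with
  | 0 => forall x, W x -> {for x, continuous f}
  | k'.+1 => (forall x, W x -> differentiable f x) /\
             (forall v : V, classC k' W ('D_v f))
  end.

(* On a set that need not be open (below, one with boundary), smooth means
   locally the restriction of a C^oo function defined on an open set. *)
Definition smooth_on (R : realType) (V : normedModType R) (A : set V)
    (f : V -> R) : Prop :=
  forall z, A z -> exists (W : set V) (g : V -> R),
    [/\ open W, W z, (forall k, classC k W g)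
      & forall w, W w -> A w -> g w = f w].

(* [f] is a total function, constrained only on [x != 0], [0 <= y]. *)
Definition admissible (R : realType) (N : nat) (a : R)
    (f : 'rV[R]_N -> R -> R) : Prop :=
  [/\ smooth_on [set z : 'rV[R]_N * R | z.1 != 0 /\ 0 <= z.2]
        (fun z => f z.1 z.2),
      forall x, x != 0 -> f x 0 = 0 /\ (forall y, 0 < y -> 0 < f x y),
      forall x y z, x != 0 -> 0 <= y -> y <= z -> f x y <= f x z
    & exists b0 : R, [/\ a - 2 < b0, - N%:R < a - 2
        & forall omega : set R, compact omega -> omega `<=` `[0, +oo[ ->
          exists2 L : R, 0 < L & forall x y z, x != 0 -> omega y -> omega z ->
            `|f x y - f x z| <= L * enorm x `^ b0 * `|y - z|]].

Definition positive_solution (R : realType) (N : nat) (a : R)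
    (f : 'rV[R]_N -> R -> R) (u : 'rV[R]_N -> R) : Prop :=
  [/\ forall x, 0 < u x,
      classC 2 [set x : 'rV[R]_N | x != 0] u,
      continuous u
    & forall x, x != 0 ->
        - divergence (fun z => enorm z `^ a *: gradient u z) x = f x (u x)].

(* Main.v *)
Require Import Defs.
From HB Require Import structures.
From mathcomp Require Import all_boot all_order all_algebra.
From mathcomp Require Import all_classical all_reals all_analysis.
From mathcomp Require Import ring lra.

Import Order.TTheory GRing.Theory Num.Theory.
Import numFieldNormedType.Exports.

Local Open Scope classical_set_scope.
Local Open Scope ring_scope.

(** Let kap = (N - 2 + a) / 2 > 0 and v x = |x|^kap u x. In the variables
    ln |x| and x / |x| the equation becomes autonomous up to the reaction term:

      P v = kap^2 v - G(x, v),   G(x, y) = |x|^(kap + 2 - a) f(x, |x|^(-kap) y),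

    where P is the sum of the second derivative in ln |x| and of the
    Laplace-Beltrami operator of the unit sphere. Hypothesis [hi] says exactly
    that G(s x, y) increases strictly with the scalar s > 0.

    Monotonicity. P commutes with the inversion x |-> lam^2 x / |x|^2, so the
    gap w = v o inversion - v satisfies a differential inequality inside the
    sphere |x| = lam, on which it vanishes. The method of moving spheres shows
    w >= 0 inside, for every lam: for small lam because the Lipschitz constant
    of G near the origin is dominated by kap^2 (this is b0 > a - 2), and past
    any such lam because the strict monotonicity of G forbids interior
    zeros of w while the new thin shell is too narrow for a negative minimum
    (lemma [gap_ge0_extend]). Near the origin w is almost nonnegative, since v
    tends to 0 there whereas its inverted copy is positive. Letting lam vary, v
    is nondecreasing along every ray ([nondecreasing_rays]), hence bounded below
    by some c > 0 outside the unit ball.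

    Contradiction. By [hii], G(x, v) >= d |x|^sg v^p for large |x|, with
    sg = 2 - a + b - kap (p - 1), and p < p_S(a, b) means sg > 0. As v >= c, far
    away P v < - 18 v. But the quartic phi = (t (1 - t))^2 in
    t = ln (|x| / r) satisfies phi'' >= - 18 phi and vanishes at the ends of
    the unit interval, so that the largest multiple of phi below v touches v
    inside the shell r < |x| < e r and gives P v >= - 18 v there
    ([no_positive_strict_supersolution]).

    All comparisons are made at a single touching point. P is therefore
    handled through second-order difference quotients along dilations and
    coordinate-plane rotations: for these, linearity, invariance under
    inversion and nonnegativity at a minimum are exact identities or
    inequalities, and derivatives enter only once, in [polar_quot_cvg]. *)

(** * Symmetric second differences and second derivatives along curves *)

Definition sdiff {R : realType} (g : R -> R) (s : R) : R :=
  g s + g (- s) - 2 * g 0.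

(** [sdiff g s - l * s ^+ 2] is even in [s], vanishes at 0 and has derivative
    o(s); the mean value theorem then makes it o(s^2). *)
Lemma sdiff_cvg {R : realType} (g g1 : R -> R) (l : R) :
  (forall s : R, is_derive s (1 : R) g (g1 s)) -> is_derive (0 : R) (1 : R) g1 l ->
  sdiff g s / s ^+ 2 @[s --> 0^'] --> l.
Proof.
move=> dg dg1.
have : (h^-1 *: (g1 (h *: 1 + 0) - g1 0)) @[h --> (0:R)^'] --> l.
  by have <- := @derive_val _ _ _ _ _ _ _ dg1; case: dg1.
move=> /cvgrPdist_le cv1.
apply/cvgrPdist_le => e e0.
have e20 : 0 < e / 2 by rewrite divr_gt0.
have /(_ _ e20) [d /= d0 Hd] := cv1.
have g1E c : `|c| < d -> `|g1 c - g1 0 - l * c| <= e / 2 * `|c|.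
  have [-> _|c0 cd] := eqVneq c 0.
    by rewrite subrr mulr0 subr0 !normr0 mulr0.
  have := Hd c; rewrite /ball_/= sub0r normrN => /(_ cd c0).
  rewrite [c%:A]mulr1 addr0 => h.
  have -> : g1 c - g1 0 - l * c = - (l - c^-1 * (g1 c - g1 0)) * c.
    by field.
  by rewrite normrM normrN ler_pM2r// normr_gt0.
pose k s := g s + g (- s) - 2 * g 0 - l * s ^+ 2.
pose k1 s := g1 s - g1 (- s) - 2 * l * s.
have dk s : is_derive s (1:R) k (k1 s).
  have dn : is_derive s (1 : R) (g \o -%R) (g1 (- s) * (-1)).
    by apply: is_derive1_comp.
  rewrite /k /k1.
  have -> : (fun s => g s + g (- s) - 2 * g 0 - l * s ^+ 2) =
    (g + (g \o -%R) - cst (2 * g 0) - l *: (id ^+ 2)) by apply/funext => t /=.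
  apply: is_derive_eq.
  by rewrite /GRing.scale/=; ring.
have kb s : 0 < s -> s < d -> `|k s| <= e * s ^+ 2.
  move=> s0 sd.
  have [|c] := @MVT _ k k1 0 s s0 (fun x _ => dk x).
    by apply: derivable_within_continuous => x _; case: (dk x).
  rewrite in_itv/= => /andP[c0 cs].
  have -> : k 0 = 0 by rewrite /k oppr0; ring.
  rewrite !subr0 => ->.
  have cd : `|c| < d by rewrite gtr0_norm// (lt_trans cs).
  have -> : k1 c = (g1 c - g1 0 - l * c) - (g1 (- c) - g1 0 - l * (- c)).
    by rewrite /k1; ring.
  rewrite normrM (gtr0_norm s0) expr2 mulrA ler_wpM2r// ?(ltW s0)//.
  apply: (le_trans (ler_normB _ _)).
  apply: (@le_trans _ _ (e / 2 * `|c| + e / 2 * `|- c|)).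
    by apply: lerD; apply: g1E; rewrite ?normrN.
  rewrite normrN -mulrDl -splitr ler_wpM2l ?(ltW e0)//.
  by rewrite gtr0_norm// ltW.
have keven s : k (- s) = k s by rewrite /k opprK sqrrN; ring.
have kb' s : s != 0 -> `|s| < d -> `|k s| <= e * s ^+ 2.
  move=> s0 sd; have [sp|sn] := ltrP 0 s.
    by apply: kb => //; rewrite gtr0_norm in sd.
  have sn' : s < 0 by rewrite lt_neqAle s0.
  rewrite -keven -(sqrrN s); apply: kb; rewrite ?oppr_gt0//.
  by rewrite ltr0_norm in sd.
exists d => //= s; rewrite /ball_/= sub0r normrN => sd s0.
have -> : l - sdiff g s / s ^+ 2 = - k s / s ^+ 2.
  by rewrite /k /sdiff; field.
have s20 : 0 < s ^+ 2 by rewrite lt_def sqr_ge0 sqrf_eq0 s0.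
rewrite normrM normrN normfV (gtr0_norm s20) ler_pdivrMr//.
exact: kb'.
Qed.

Lemma is_derive_row {R : realType} {N : nat} (c : R -> 'rV[R]_N) (s : R)
    (dc : 'rV[R]_N) :
  (forall k, is_derive s (1 : R) (fun t => c t 0 k) (dc 0 k)) -> is_derive s (1:R) c dc.
Proof.
move=> H.
have dM : derivable c s 1.
  by apply/derivable_mxP => i j; rewrite ord1; case: (H j).
apply: DeriveDef => //.
rewrite derive_mx//; apply/matrixP => i j; rewrite !mxE ord1.
by have [_ ->] := H j.
Qed.

Lemma diff_partials {R : realType} {N : nat} (u : 'rV[R]_N -> R) (x w : 'rV[R]_N) :
  differentiable u x -> 'd u x w = \sum_k w 0 k * 'D_(delta_mx 0 k) u x.
Proof.
move=> du; rewrite {1}(row_sum_delta w) linear_sum/=.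
by apply: eq_bigr => k _; rewrite linearZ/= deriveE.
Qed.

Lemma is_derive_along {R : realType} {N : nat} (u : 'rV[R]_N -> R)
    (c : R -> 'rV[R]_N) (s : R) (dc : 'rV[R]_N) :
  differentiable u (c s) -> (forall k, is_derive s (1 : R) (fun t => c t 0 k) (dc 0 k)) ->
  is_derive s (1 : R) (u \o c) (\sum_k dc 0 k * 'D_(delta_mx 0 k) u (c s)).
Proof.
move=> du /is_derive_row dcs.
have dc' : differentiable c s by apply/derivable1_diffP; case: dcs.
have duc : differentiable (u \o c) s by exact: differentiable_comp.
apply: DeriveDef; first by apply/derivable1_diffP.
rewrite deriveE// diff_comp//=.
have -> : 'd c s 1 = dc by rewrite -deriveE//; case: dcs.
by rewrite diff_partials.
Qed.

(** The second-order chain rule along a curve. The exponential factor is what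
    the weight |x|^kap becomes along the dilations x |-> e^s x. *)
Lemma sdiff_along_cvg {R : realType} {N : nat} (u : 'rV[R]_N -> R)
    (c c1 : R -> 'rV[R]_N) (c2 : 'rV[R]_N) (kap : R) :
  classC 2 [set x : 'rV[R]_N | x != 0] u ->
  (forall s, c s != 0) ->
  (forall (s : R) k, is_derive s (1 : R) (fun t => c t 0 k) (c1 s 0 k)) ->
  (forall k, is_derive (0 : R) (1 : R) (fun t => c1 t 0 k) (c2 0 k)) ->
  sdiff (fun s => expR (kap * s) * u (c s)) s / s ^+ 2 @[s --> 0^'] -->
  kap ^+ 2 * u (c 0) + 2 * kap * (\sum_k c1 0 0 k * 'D_(delta_mx 0 k) u (c 0))
  + \sum_k c2 0 k * 'D_(delta_mx 0 k) u (c 0)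
  + \sum_k \sum_l c1 0 0 k * c1 0 0 l *
      'D_(delta_mx 0 l) ('D_(delta_mx 0 k) u) (c 0).
Proof.
move=> [du dDu] c0 dc dc1.
pose U1 s := \sum_k c1 s 0 k * 'D_(delta_mx 0 k) u (c s).
have dU s : is_derive s (1 : R) (u \o c) (U1 s).
  by apply: is_derive_along => //; apply: du; exact: c0.
have dE s : is_derive s (1 : R) (fun t => expR (kap * t)) (kap * expR (kap * s)).
  have h : is_derive s (1 : R) (fun t => kap * t) kap.
    have -> : (fun t => kap * t) = kap *: id by [].
    by apply: is_derive_eq; rewrite [RHS]/= [LHS]mulr1.
  rewrite mulrC.
  exact: (@is_derive1_comp _ expR (fun t => kap * t)).
apply: (@sdiff_cvg _ _ (fun s => expR (kap * s) * (kap * u (c s) + U1 s))).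
  move=> s.
  have -> : (fun s => expR (kap * s) * u (c s)) =
    (fun t => expR (kap * t)) * (u \o c) by [].
  apply: is_derive_eq.
  by rewrite /GRing.scale/=; ring.
have dU1 : is_derive (0:R) (1:R) U1
   (\sum_k (c2 0 k * 'D_(delta_mx 0 k) u (c 0) + c1 0 0 k *
      \sum_l c1 0 0 l * 'D_(delta_mx 0 l) ('D_(delta_mx 0 k) u) (c 0))).
  have -> : U1 = \sum_k (fun t => c1 t 0 k) * ('D_(delta_mx 0 k) u \o c).
    by apply/funext => t; rewrite fct_sumE.
  apply: is_derive_sum => k.
  have h : is_derive (0:R) (1:R) ('D_(delta_mx 0 k) u \o c)
     (\sum_l c1 0 0 l * 'D_(delta_mx 0 l) ('D_(delta_mx 0 k) u) (c 0)).
    apply: is_derive_along => //.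
    by case: (dDu (delta_mx 0 k)) => + _; apply; exact: c0.
  by apply: is_derive_eq; rewrite /GRing.scale/=; ring.
have -> : (fun s => expR (kap * s) * (kap * u (c s) + U1 s)) =
    (fun t => expR (kap * t)) * (kap *: (u \o c) + U1) by [].
apply: is_derive_eq.
rewrite big_split/= !fctE !mulr0 expR0.
under [X in _ + (_ + X)]eq_bigr do rewrite mulr_sumr.
under [X in _ = _ + X]eq_bigr do under eq_bigr do rewrite -mulrA.
by rewrite /GRing.scale/= /U1; ring.
Qed.

(** * The Laplacian in polar form *)

Section Enorm.
Context {R : realType} {N : nat}.
Implicit Types (x : 'rV[R]_N).

Lemma sqr_enorm x : enorm x ^+ 2 = \sum_i x 0 i ^+ 2.
Proof. by rewrite sqr_sqrtr// sumr_ge0// => i _; rewrite sqr_ge0. Qed.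

Lemma enorm_ge0 x : 0 <= enorm x.
Proof. exact: sqrtr_ge0. Qed.

Lemma enorm_gt0 x : (0 < enorm x) = (x != 0).
Proof.
rewrite lt_def enorm_ge0 andbT; congr (~~ _).
apply/idP/idP => [/eqP x0|/eqP ->]; last first.
  by rewrite /enorm big1 ?sqrtr0// => i _; rewrite mxE expr0n.
apply/eqP/rowP => i; rewrite mxE; apply/eqP; rewrite -sqrf_eq0.
have /eqP := sqr_enorm x; rewrite x0 expr0n/= eq_sym psumr_eq0.
  by move=> /allP/(_ i (mem_index_enum i)).
by move=> j _; rewrite sqr_ge0.
Qed.

Lemma enormZ (c : R) x : enorm (c *: x) = `|c| * enorm x.
Proof.
rewrite /enorm -sqrtr_sqr -sqrtrM ?sqr_ge0// mulr_sumr; congr Num.sqrt.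
by apply: eq_bigr => i _; rewrite mxE exprMn.
Qed.

Lemma enormZ_ge0 (c : R) x : 0 <= c -> enorm (c *: x) = c * enorm x.
Proof. by move=> c0; rewrite enormZ ger0_norm. Qed.

(** The rotation of angle [s] in the plane of the coordinates [i] and [j], as
    long as [i] and [j] differ. *)
Definition plane_rot (i j : 'I_N) (s : R) x : 'rV[R]_N :=
  x + ((cos s - 1) * x 0 i - sin s * x 0 j) *: delta_mx 0 i
    + (sin s * x 0 i + (cos s - 1) * x 0 j) *: delta_mx 0 j.

Lemma plane_rotZ i j s (c : R) x : plane_rot i j s (c *: x) = c *: plane_rot i j s x.
Proof. by apply/rowP => k; rewrite !mxE; ring. Qed.

Lemma plane_rot0 i j x : plane_rot i j 0 x = x.
Proof. by apply/rowP => k; rewrite !mxE cos0 sin0; ring. Qed.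

Lemma enorm_plane_rot i j s x : j != i -> enorm (plane_rot i j s x) = enorm x.
Proof.
move=> ji; rewrite /enorm; congr Num.sqrt.
rewrite (bigD1 i)// (bigD1 j)//= [RHS](bigD1 i)// [X in _ = _ + X](bigD1 j)//=.
rewrite !addrA; congr (_ + _).
  rewrite !mxE !eqxx (negbTE ji) [i == j]eq_sym (negbTE ji)/=.
  transitivity ((cos s ^+ 2 + sin s ^+ 2) * (x 0 i ^+ 2 + x 0 j ^+ 2)); first by ring.
  by rewrite cos2Dsin2 mul1r.
apply: eq_bigr => k /andP[ki kj].
by rewrite !mxE (negbTE ki) (negbTE kj)/=; ring.
Qed.

Lemma sum_delta2 (i j : 'I_N) (p q : R) (F : 'I_N -> R) :
  \sum_k (p *: delta_mx 0 i + q *: delta_mx 0 j : 'rV[R]_N) 0 k * F k =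
  p * F i + q * F j.
Proof.
under eq_bigr do rewrite !mxE eqxx/= mulrDl -!mulrA.
rewrite big_split/= -!mulr_sumr; congr (_ * _ + _ * _).
- rewrite (bigD1 i)//= eqxx mul1r big1 ?addr0// => k /negbTE ->.
  by rewrite mul0r.
- rewrite (bigD1 j)//= eqxx mul1r big1 ?addr0// => k /negbTE ->.
  by rewrite mul0r.
Qed.

Lemma sum_delta2_sqr (i j : 'I_N) (p q : R) (F : 'I_N -> 'I_N -> R) :
  let w : 'rV[R]_N := p *: delta_mx 0 i + q *: delta_mx 0 j in
  \sum_k \sum_l w 0 k * w 0 l * F k l =
  p * (p * F i i + q * F i j) + q * (p * F j i + q * F j j).
Proof.
move=> w; rewrite -[RHS](sum_delta2 i j p q (fun k => p * F k i + q * F k j)).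
apply: eq_bigr => k _; rewrite -(sum_delta2 i j p q (F k)) mulr_sumr.
by apply: eq_bigr => l _; rewrite mulrA.
Qed.

(** Second difference along the dilations plus, over all coordinate planes, the
    second differences along the rotations; each plane is counted twice, hence
    the factor 1/2. The infinitesimal version is the square of the Euler
    operator plus the Laplace-Beltrami operator of the sphere. *)
Definition polar_sdiff (v : 'rV[R]_N -> R) x (s : R) : R :=
  sdiff (fun t => v (expR t *: x)) s
  + 2^-1 * \sum_i \sum_(j | j != i) sdiff (fun t => v (plane_rot i j t x)) s.

Definition polar_quot v x (s : R) : R := polar_sdiff v x s / s ^+ 2.

(** Half the sum of the squares of the angular momenta
    x_i d_j - x_j d_i, applied to a function of gradient [g] and Hessian [h], is
    |x|^2 Laplacian - sum_ij x_i x_j d_i d_j - (N - 1) sum_i x_i d_i. *)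
Lemma polar_algebra (x g : 'I_N -> R) (h : 'I_N -> 'I_N -> R) :
  2^-1 * \sum_i \sum_(j | j != i)
     (- x i * g i + - x j * g j + (- x j * (- x j * h i i + x i * h i j)
                 + x i * (- x j * h j i + x i * h j j)))
  = (\sum_i x i ^+ 2) * (\sum_i h i i) - \sum_i \sum_j x i * x j * h i j
    - (N%:R - 1) * \sum_i x i * g i.
Proof.
pose T i j := - x i * g i + - x j * g j + (- x j * (- x j * h i i + x i * h i j)
                 + x i * (- x j * h j i + x i * h j j)).
(* The diagonal term T i i equals - 2 x_i g_i. *)
have E i : \sum_(j | j != i) T i j = \sum_j T i j + 2 * (x i * g i).
  by rewrite [in RHS](bigD1 i)//= /T; ring.
rewrite (eq_bigr _ (fun i _ => E i)) big_split/=.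
have -> : \sum_(i < N) \sum_(j < N) T i j =
    \sum_(i < N) \sum_(j < N) (- (x i * g i)) + \sum_(i < N) \sum_(j < N) (- (x j * g j))
    + (\sum_(i < N) \sum_(j < N) (x j ^+ 2 * h i i) + \sum_(i < N) \sum_(j < N) (x i ^+ 2 * h j j))
    - (\sum_(i < N) \sum_(j < N) x i * x j * h i j + \sum_(i < N) \sum_(j < N) x i * x j * h j i).
  rewrite -!big_split/= -sumrB; apply: eq_bigr => i _.
  rewrite -!big_split/= -sumrB; apply: eq_bigr => j _.
  by rewrite /T; ring.
have -> : \sum_(i < N) \sum_(j < N) x i * x j * h j i =
    \sum_(i < N) \sum_(j < N) x i * x j * h i j.
  rewrite exchange_big; apply: eq_bigr => i _; apply: eq_bigr => j _.
  by rewrite (mulrC (x j)).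
have -> : \sum_(i < N) \sum_(j < N) x i ^+ 2 * h j j =
    (\sum_i x i ^+ 2) * \sum_i h i i.
  by rewrite mulr_suml; apply: eq_bigr => i _; rewrite mulr_sumr.
have -> : \sum_(i < N) \sum_(j < N) x j ^+ 2 * h i i =
    (\sum_i x i ^+ 2) * \sum_i h i i.
  by rewrite mulr_sumr; apply: eq_bigr => i _; rewrite mulr_suml.
have cst_sum i : \sum_(j < N) - (x i * g i) = - N%:R * (x i * g i).
  by rewrite sumr_const card_ord -mulr_natl; ring.
have -> : \sum_(i < N) \sum_(j < N) - (x j * g j) = - N%:R * \sum_i x i * g i.
  rewrite exchange_big mulr_sumr; apply: eq_bigr => i _; exact: cst_sum.
have -> : \sum_(i < N) \sum_(j < N) - (x i * g i) = - N%:R * \sum_i x i * g i.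
  by rewrite mulr_sumr; apply: eq_bigr => i _; exact: cst_sum.
by rewrite -mulr_sumr; field.
Qed.

End Enorm.

Section PolarLimit.
Context {R : realType} {N : nat}.
Variables (u : 'rV[R]_N -> R).
Hypothesis uC2 : classC 2 [set x : 'rV[R]_N | x != 0] u.
Let D k := 'D_(delta_mx 0 k) u.
Let H x k l := 'D_(delta_mx 0 l) ('D_(delta_mx 0 k) u) x.

Lemma radial_sdiff_cvg (kap : R) (x : 'rV[R]_N) : x != 0 ->
  sdiff (fun s => expR (kap * s) * u (expR s *: x)) s / s ^+ 2 @[s --> 0^'] -->
  kap ^+ 2 * u x + (2 * kap + 1) * (\sum_k x 0 k * D k x)
  + \sum_k \sum_l x 0 k * x 0 l * H x k l.
Proof.
move=> x0.
have dc k (s : R) : is_derive s (1:R) (fun t => (expR t *: x) 0 k) ((expR s *: x) 0 k).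
  have -> : (fun t => (expR t *: x) 0 k) = x 0 k *: expR.
    by apply/funext => t; rewrite mxE mulrC.
  by apply: is_derive_eq; rewrite mxE /GRing.scale/= mulrC.
have := @sdiff_along_cvg R N u (fun t => expR t *: x) (fun t => expR t *: x) x kap uC2.
rewrite expR0 scale1r => h.
set S := \sum_k x 0 k * D k x.
have -> : (2 * kap + 1) * S = 2 * kap * S + S by ring.
rewrite !addrA; apply: h => //.
- by move=> s; rewrite scaler_eq0 negb_or x0 gt_eqF ?expR_gt0.
- by move=> k; have := dc k 0; rewrite expR0 scale1r.
Qed.

Lemma rot_sdiff_cvg (i j : 'I_N) (x : 'rV[R]_N) : x != 0 -> j != i ->
  sdiff (fun s => u (plane_rot i j s x)) s / s ^+ 2 @[s --> 0^'] -->
  - x 0 i * D i x + - x 0 j * D j x +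
   (- x 0 j * (- x 0 j * H x i i + x 0 i * H x i j)
                 + x 0 i * (- x 0 j * H x j i + x 0 i * H x j j)).
Proof.
move=> x0 ji.
pose c1 (s : R) : 'rV[R]_N := (- sin s * x 0 i - cos s * x 0 j) *: delta_mx 0 i
   + (cos s * x 0 i - sin s * x 0 j) *: delta_mx 0 j.
pose c2 : 'rV[R]_N := (- x 0 i) *: delta_mx 0 i + (- x 0 j) *: delta_mx 0 j.
have c0 s : plane_rot i j s x != 0 by rewrite -enorm_gt0 enorm_plane_rot// enorm_gt0.
have dc (s : R) k : is_derive s (1 : R) (fun t => plane_rot i j t x 0 k) (c1 s 0 k).
  pose p : R := (delta_mx 0 i : 'rV[R]_N) 0 k.
  pose q : R := (delta_mx 0 j : 'rV[R]_N) 0 k.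
  have -> : (fun t => plane_rot i j t x 0 k) =
    cst (x 0 k - p * x 0 i - q * x 0 j) + (p * x 0 i + q * x 0 j) *: cos
    + (q * x 0 i - p * x 0 j) *: sin.
    by apply/funext => t; rewrite !fctE /plane_rot !mxE /GRing.scale/= /p /q !mxE; ring.
  apply: (is_derive_eq (is_deriveD (is_deriveD (is_derive_cst _ _ _)
    (is_deriveZ _ (is_derive_cos s))) (is_deriveZ _ (is_derive_sin s)))).
  by rewrite /c1 !mxE /p /q !mxE /GRing.scale/=; ring.
have dc1 k : is_derive (0 : R) (1 : R) (fun t => c1 t 0 k) (c2 0 k).
  pose p : R := (delta_mx 0 i : 'rV[R]_N) 0 k.
  pose q : R := (delta_mx 0 j : 'rV[R]_N) 0 k.
  have -> : (fun t => c1 t 0 k) =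
    (- p * x 0 i - q * x 0 j) *: sin + (q * x 0 i - p * x 0 j) *: cos.
    by apply/funext => t; rewrite !fctE /c1 !mxE /GRing.scale/= /p /q !mxE; ring.
  apply: (is_derive_eq (is_deriveD (is_deriveZ _ (is_derive_sin 0))
    (is_deriveZ _ (is_derive_cos 0)))).
  by rewrite /c2 !mxE /p /q !mxE /GRing.scale/= sin0 cos0; ring.
have := @sdiff_along_cvg R N u (fun t => plane_rot i j t x) c1 c2 0 uC2 c0 dc dc1.
have -> : c1 0 = (- x 0 j) *: delta_mx 0 i + (x 0 i) *: delta_mx 0 j.
  by rewrite /c1 sin0 cos0; congr (_ *: _ + _ *: _); ring.
rewrite plane_rot0.
have -> : (fun s => expR (0 * s) * u (plane_rot i j s x)) = (fun s => u (plane_rot i j s x)).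
  by apply/funext => s; rewrite mul0r expR0 mul1r.
rewrite /c2 (sum_delta2_sqr _ _ _ _ (H x)) !(sum_delta2 _ _ _ _ (fun k => D k x)).
by rewrite expr0n/= mul0r mulr0 mul0r !add0r.
Qed.

Lemma sdiffMl (k : R) (g : R -> R) (s : R) :
  sdiff (fun t => k * g t) s = k * sdiff g s.
Proof. by rewrite /sdiff; ring. Qed.

(** The second-order radial terms of the dilation part and of the rotation part
    cancel, leaving the full Laplacian and a multiple of the Euler operator. *)
Lemma polar_quot_cvg (kap : R) (x : 'rV[R]_N) : x != 0 ->
  polar_quot (fun z => enorm z `^ kap * u z) x s @[s --> 0^'] -->
  enorm x `^ kap * (kap ^+ 2 * u x + enorm x ^+ 2 * (\sum_k H x k k)
    + (2 * kap + 2 - N%:R) * \sum_k x 0 k * D k x).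
Proof.
move=> x0.
have ex : 0 < enorm x by rewrite enorm_gt0.
set K := enorm x `^ kap.
have -> : polar_quot (fun z => enorm z `^ kap * u z) x =
  (fun s => K * (sdiff (fun s => expR (kap * s) * u (expR s *: x)) s / s ^+ 2
     + 2^-1 * \sum_i \sum_(j | j != i) (sdiff (fun s => u (plane_rot i j s x)) s / s ^+ 2))).
  apply/funext => s; rewrite /polar_quot /polar_sdiff.
  have -> : sdiff (fun t => enorm (expR t *: x) `^ kap * u (expR t *: x)) s =
     K * sdiff (fun s => expR (kap * s) * u (expR s *: x)) s.
    have -> : (fun t => enorm (expR t *: x) `^ kap * u (expR t *: x)) =
      (fun t => K * (expR (kap * t) * u (expR t *: x))); last exact: sdiffMl.
    apply/funext => t; rewrite enormZ_ge0 ?expR_ge0// powRM ?expR_ge0 ?enorm_ge0//.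
    by rewrite [in LHS]/powR gt_eqF ?expR_gt0// expRK -/K mulrCA mulrA.
  rewrite mulrDl [RHS]mulrDr -[K * _ / _]mulrA; congr (_ + _).
  rewrite -[LHS]mulrA [RHS]mulrCA; congr (_ * _).
  rewrite mulr_suml mulr_sumr; apply: eq_bigr => i _.
  rewrite mulr_suml mulr_sumr; apply: eq_bigr => j ji.
  have -> : (fun t => enorm (plane_rot i j t x) `^ kap * u (plane_rot i j t x)) =
      (fun t => K * u (plane_rot i j t x)) by apply/funext => t; rewrite enorm_plane_rot.
  by rewrite sdiffMl -mulrA.
apply: cvgMl_tmp.
have -> : kap ^+ 2 * u x + enorm x ^+ 2 * (\sum_k H x k k)
    + (2 * kap + 2 - N%:R) * (\sum_k x 0 k * D k x) =
   (kap ^+ 2 * u x + (2 * kap + 1) * (\sum_k x 0 k * D k x)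
  + \sum_k \sum_l x 0 k * x 0 l * H x k l) +
  2^-1 * \sum_i \sum_(j | j != i)
     (- x 0 i * D i x + - x 0 j * D j x +
   (- x 0 j * (- x 0 j * H x i i + x 0 i * H x i j)
                 + x 0 i * (- x 0 j * H x j i + x 0 i * H x j j))).
  rewrite (polar_algebra (x 0) (fun i => D i x) (H x)) sqr_enorm; ring.
apply: cvgD; first exact: radial_sdiff_cvg.
apply: cvgMl_tmp; apply: cvg_big => [|i _]; first exact: add_continuous.
apply: cvg_big => [|j ji]; first exact: add_continuous.
exact: rot_sdiff_cvg.
Qed.

End PolarLimit.

(** * The weighted divergence *)

Lemma powRD_gt0 {R : realType} (x r s : R) : 0 < x ->
  x `^ (r + s) = x `^ r * x `^ s.
Proof. by move=> x0; rewrite powRD// (gt_eqF x0) implybT. Qed.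

Section WeightedDivergence.
Context {R : realType} {N : nat}.
Implicit Types (x : 'rV[R]_N).

Lemma is_derive_line (f : 'rV[R]_N -> R) x v l :
  is_derive (0 : R) (1 : R) (fun h : R => f (h *: v + x)) l -> is_derive x v f l.
Proof.
move=> [df dl]; apply: DeriveDef; first exact: (derivable1P _ _ _).2.
have E : (fun h : R => h^-1 *: (f (h *: v + x) - f x)) =
  (fun h : R => h^-1 *: (f ((h *: 1 + 0 : R) *: v + x) - f ((0:R) *: v + x))).
  by apply/funext => h; rewrite addr0 [h%:A]mulr1 scale0r add0r.
by rewrite -dl /derive E.
Qed.

(** Restricting to the line through [x] along a coordinate axis reduces the
    claim to one-variable calculus for |.|^2 to the power a / 2. *)
Lemma is_derive_enorm_powR (a : R) x (i : 'I_N) : x != 0 ->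
  is_derive x (delta_mx 0 i : 'rV[R]_N) (fun z => enorm z `^ a)
    (a * enorm x `^ (a - 2) * x 0 i).
Proof.
move=> x0; apply: is_derive_line.
have ex : 0 < enorm x by rewrite enorm_gt0.
pose S (h : R) := \sum_k (h *: delta_mx 0 i + x) 0 k ^+ 2.
have S0 : S 0 = enorm x ^+ 2.
  by rewrite /S scale0r add0r sqr_enorm.
have dS : is_derive (0 : R) (1 : R) S (2 * x 0 i).
  have -> : S = \sum_k ((delta_mx 0 i : 'rV[R]_N) 0 k *: id + cst (x 0 k)) ^+ 2.
    apply/funext => h; rewrite fct_sumE; apply: eq_bigr => k _.
    by rewrite !fctE !mxE mulrC.
  have -> : 2 * x 0 i = \sum_k 2 * x 0 k * (delta_mx 0 i : 'rV[R]_N) 0 k.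
    rewrite (bigD1 i)//= !mxE !eqxx/= mulr1 big1 ?addr0// => k /negbTE ki.
    by rewrite !mxE ki mulr0.
  apply: is_derive_sum => k; apply: is_derive_eq.
  by rewrite !fctE /GRing.scale/=; ring.
have -> : (fun h : R => enorm (h *: delta_mx 0 i + x) `^ a) =
    (fun y : R => y `^ (2^-1 * a)) \o S.
  apply/funext => h /=; rewrite /enorm -powR12_sqrt ?powRrM//.
  by rewrite sumr_ge0// => k _; rewrite sqr_ge0.
have S0p : 0 < S 0 by rewrite S0 exprn_gt0.
have dp := @is_derive1_powR R (2^-1 * a) _ S0p.
apply: (@is_derive_eq _ _ _ _ _ _ _ _ (is_derive1_comp dp dS)).
rewrite S0 -powR_mulrn ?enorm_ge0// -powRrM.
have -> : 2%:R * (2^-1 * a - 1) = a - 2 by field.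
by field.
Qed.

Lemma divergence_weighted (u : 'rV[R]_N -> R) (a : R) x :
  classC 2 [set x : 'rV[R]_N | x != 0] u -> x != 0 ->
  divergence (fun z => enorm z `^ a *: gradient u z) x =
  enorm x `^ a * \sum_k 'D_(delta_mx 0 k) ('D_(delta_mx 0 k) u) x
  + a * enorm x `^ (a - 2) * \sum_k x 0 k * 'D_(delta_mx 0 k) u x.
Proof.
move=> [_ dDu] x0; rewrite /divergence !mulr_sumr -big_split/=.
apply: eq_bigr => k _.
have -> : (fun z => (enorm z `^ a *: gradient u z) 0 k) =
  (fun z => enorm z `^ a) * 'D_(delta_mx 0 k) u.
  by apply/funext => z; rewrite !mxE.
have h1 := is_derive_enorm_powR a x k x0.
have h2 : derivable ('D_(delta_mx 0 k) u) x (delta_mx 0 k).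
  by apply: diff_derivable; case: (dDu (delta_mx 0 k)) => + _; exact.
have [_ ->] := is_deriveM h1 (derivableP h2).
by rewrite /GRing.scale/=; ring.
Qed.

(** With kap = (N - 2 + a) / 2 the coefficient 2 kap + 2 - N of the Euler operator
    in [polar_quot_cvg] is [a], which is also the one produced by
    the weight |x|^a; this is the reason for that exponent. *)
Lemma solution_polar_quot_cvg (a : R) (f : 'rV[R]_N -> R -> R) (u : 'rV[R]_N -> R)
    (kap : R) x : kap = (N%:R - 2 + a) / 2 ->
  positive_solution a f u -> x != 0 ->
  polar_quot (fun z => enorm z `^ kap * u z) x s @[s --> 0^'] -->
  kap ^+ 2 * (enorm x `^ kap * u x) - enorm x `^ (kap + 2 - a) * f x (u x).
Proof.
move=> kapE [_ uC2 _ eqn] x0.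
have ex : 0 < enorm x by rewrite enorm_gt0.
rewrite -eqn// (divergence_weighted u a)//.
have := @polar_quot_cvg _ _ u uC2 kap x x0.
set P := polar_quot _ _.
set L1 := (X in _ --> X -> _); set L2 := (X in _ -> _ --> X).
suff -> : L1 = L2 by [].
rewrite {}/L1 {}/L2.
have E1 : enorm x `^ (kap + 2 - a) * enorm x `^ a = enorm x `^ kap * enorm x ^+ 2.
  rewrite -powR_mulrn ?enorm_ge0// -!powRD_gt0//.
  by congr (_ `^ _); ring.
have E2 : enorm x `^ (kap + 2 - a) * enorm x `^ (a - 2) = enorm x `^ kap.
  rewrite -powRD_gt0//.
  by congr (_ `^ _); ring.
set W := enorm x `^ (kap + 2 - a) in E1 E2 *.
set S2 := \sum_k 'D__ ('D__ _) _; set S1 := \sum_k x 0 k * _.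
transitivity (kap ^+ 2 * (enorm x `^ kap * u x) +
  (W * enorm x `^ a) * S2 + a * (W * enorm x `^ (a - 2)) * S1); last by ring.
by rewrite E1 E2 kapE; field.
Qed.

End WeightedDivergence.

(** * Shells, touching points and inversions *)

Section Shells.
Context {R : realType} {N : nat}.
Implicit Types (x z : 'rV[R]_N).

Lemma continuous_enorm : continuous (@enorm R N).
Proof.
move=> x; rewrite /enorm.
apply: (@continuous_comp _ _ _ (fun z : 'rV[R]_N => \sum_i z 0 i ^+ 2) Num.sqrt).
  have h i : z 0 i ^+ 2 @[z --> x] --> x 0 i ^+ 2.
    apply: (@continuous_comp _ _ _ (fun z : 'rV[R]_N => z 0 i) (fun y => y ^+ 2)).
      exact: coord_continuous.
    exact: exprn_continuous.
  exact: (@cvg_big _ _ _ _ _ add_continuous _ _ _ _ _ (nbhs_filter x)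
    (fun i _ => h i)).
exact: sqrt_continuous.
Qed.

Definition shell (r1 r2 : R) : set 'rV[R]_N := [set z | r1 <= enorm z <= r2].

Lemma compact_shell r1 r2 : compact (shell r1 r2).
Proof.
apply: bounded_closed_compact.
  exists r2; split; first exact: num_real.
  move=> M r2M z /andP[_ zr2] /=.
  have M0 : 0 <= M by rewrite (le_trans (enorm_ge0 z))// (le_trans zr2)// ltW.
  rewrite [leLHS]/Num.Def.normr/= mx_normrE; apply: bigmax_le => // -[i j] _ /=.
  rewrite ord1 (le_trans _ (ltW r2M))// (le_trans _ zr2)//.
  rewrite -sqrtr_sqr ler_wsqrtr// (bigD1 j)//= lerDl sumr_ge0// => k _.
  by rewrite sqr_ge0.
have -> : shell r1 r2 = @enorm R N @^-1` `[r1, r2].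
  by apply/seteqP; split=> z; rewrite /shell/= in_itv.
apply: preimage_closed; last exact: itv_closed.
by move=> z _; exact: continuous_enorm.
Qed.

Lemma shell_neq0 r1 r2 z : 0 < r1 -> shell r1 r2 z -> z != 0.
Proof. by move=> r10 /andP[r1z _]; rewrite -enorm_gt0 (lt_le_trans r10). Qed.

(** Rotations stay on the sphere of [x] and small dilations stay in the shell, so
    no point outside of the shell is ever tested. *)
Lemma polar_sdiff_min (g : 'rV[R]_N -> R) x (r1 r2 : R) :
  0 <= r1 -> r1 < enorm x < r2 ->
  (forall z, r1 < enorm z < r2 -> g x <= g z) ->
  \forall s \near 0^', 0 <= polar_sdiff g x s.
Proof.
move=> r10 /andP[r1x xr2] gmin.
have h s : r1 < enorm (expR s *: x) < r2 -> g x <= g (expR s *: x) by exact: gmin.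
have nearE : \forall s \near (0:R), r1 < enorm (expR s *: x) < r2.
  have cE : enorm (expR s *: x) @[s --> (0:R)] --> enorm x.
    have -> : (fun s => enorm (expR s *: x)) = (fun s => expR s * enorm x).
      by apply/funext => s; rewrite enormZ_ge0 ?expR_ge0.
    have e0 : expR s @[s --> (0:R)] --> expR 0 by exact: continuous_expR.
    have := cvgMr_tmp (b := enorm x) e0.
    by rewrite expR0 mul1r; apply.
  near=> s; apply/andP; split; near: s.
    exact: (cvgr_gt _ cE _ r1x).
  exact: (cvgr_lt _ cE _ xr2).
have nearEN : \forall s \near (0:R), r1 < enorm (expR (- s) *: x) < r2.
  have cN : - s @[s --> (0:R)] --> (0:R).
    by rewrite -[X in _ --> X]oppr0; apply: cvgN; exact: cvg_id.
  exact: (cN _ nearE).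
apply: nbhs_dnbhs; near=> s.
rewrite /polar_sdiff addr_ge0//.
  rewrite /sdiff expR0 scale1r mulr_natl mulr2n opprD addrACA addr_ge0// subr_ge0.
    by apply: h; near: s.
  by apply: h; near: s.
rewrite mulr_ge0// sumr_ge0// => i _; rewrite sumr_ge0// => j ji.
rewrite /sdiff plane_rot0 mulr_natl mulr2n opprD addrACA addr_ge0// subr_ge0;
  by apply: gmin; rewrite enorm_plane_rot// r1x.
Unshelve. all: by end_near. Qed.

(** The maximum principle at a touching point. For the comparison
    function [q] an inequality valid for every step [s] is enough, and is what
    polynomials in ln |x| provide. *)
Lemma touching (p q : 'rV[R]_N -> R) x (r1 r2 l c : R) :
  0 <= r1 -> r1 < enorm x < r2 ->
  (forall z, r1 < enorm z < r2 -> p x + q x <= p z + q z) ->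
  polar_quot p x s @[s --> 0^'] --> l ->
  (forall s, polar_sdiff q x s <= c * s ^+ 2) ->
  - c <= l.
Proof.
move=> r10 r1x pqmin pl qc.
have pqD s : polar_sdiff (fun z => p z + q z) x s =
    polar_sdiff p x s + polar_sdiff q x s.
  rewrite /polar_sdiff.
  have -> : sdiff (fun t => p (expR t *: x) + q (expR t *: x)) s =
    sdiff (fun t => p (expR t *: x)) s + sdiff (fun t => q (expR t *: x)) s.
    by rewrite /sdiff; ring.
  rewrite [RHS]addrACA -mulrDr -big_split/=; congr (_ + _ * _).
  apply: eq_bigr => i _; rewrite -big_split/=; apply: eq_bigr => j _.
  by rewrite /sdiff; ring.
have near0 := @polar_sdiff_min (fun z => p z + q z) x r1 r2 r10 r1x pqmin.
rewrite leNgt; apply/negP => lc.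
have nearl : \forall s \near (0 : R)^', polar_quot p x s < - c.
  exact: (cvgr_lt _ pl _ lc).
near (0 : R)^' => s.
have s0 : s != 0 by near: s; exact: nbhs_dnbhs_neq.
have s20 : 0 < s ^+ 2 by rewrite lt_def sqr_ge0 sqrf_eq0 s0.
have : polar_quot p x s < - c by near: s.
rewrite /polar_quot ltr_pdivrMr// mulNr -subr_lt0 opprK.
have : 0 <= polar_sdiff p x s + polar_sdiff q x s by rewrite -pqD; near: s.
by move=> h1; rewrite ltNge (le_trans h1)// lerD2l.
Unshelve. all: by end_near. Qed.

Lemma polar_sdiff_radial (Phi : R -> R) x s : x != 0 ->
  polar_sdiff (fun z => Phi (ln (enorm z))) x s =
  sdiff (fun t => Phi (t + ln (enorm x))) s.
Proof.
rewrite -enorm_gt0 => x0; rewrite /polar_sdiff [X in _ + _ * X]big1 ?mulr0 ?addr0.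
  rewrite /sdiff !enormZ_ge0 ?expR_ge0// !lnM ?posrE ?expR_gt0//.
  by rewrite !expRK.
move=> i _; apply: big1 => j ji.
by rewrite /sdiff !enorm_plane_rot//; ring.
Qed.

Definition invert (lam : R) x := (lam ^+ 2 / enorm x ^+ 2) *: x.

Lemma enorm_invert lam x : x != 0 -> enorm (invert lam x) = lam ^+ 2 / enorm x.
Proof.
rewrite -enorm_gt0 => x0; rewrite enormZ_ge0 ?divr_ge0 ?sqr_ge0//.
by field; rewrite gt_eqF.
Qed.

Lemma invert_neq0 lam x : 0 < lam -> x != 0 -> invert lam x != 0.
Proof.
move=> l0 x0; rewrite -enorm_gt0 enorm_invert// divr_gt0 ?exprn_gt0//.
by rewrite enorm_gt0.
Qed.

Lemma invert_sphere lam x : 0 < lam -> enorm x = lam -> invert lam x = x.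
Proof. by move=> l0 xl; rewrite /invert xl divff ?scale1r// expf_neq0// gt_eqF. Qed.

(** The inversion commutes with rotations and turns e^t into e^(- t), and second
    differences are even: the polar operator is exactly inversion-invariant. *)
Lemma polar_sdiff_invert (v : 'rV[R]_N -> R) lam x s : x != 0 ->
  polar_sdiff (v \o invert lam) x s = polar_sdiff v (invert lam x) s.
Proof.
rewrite -enorm_gt0 => x0; rewrite /polar_sdiff; congr (_ + _ * _).
  have E t : invert lam (expR t *: x) = expR (- t) *: invert lam x.
    rewrite /invert enormZ_ge0 ?expR_ge0// !scalerA expRN; congr (_ *: _).
    have et : 0 < expR t by exact: expR_gt0.
    by field; rewrite !gt_eqF.
  by rewrite /sdiff/= !E !opprK oppr0; ring.
apply: eq_bigr => i _; apply: eq_bigr => j ji.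
have E t : invert lam (plane_rot i j t x) = plane_rot i j t (invert lam x).
  by rewrite /invert enorm_plane_rot// plane_rotZ.
by rewrite /sdiff/= !E.
Qed.

Lemma invert_continuous2 (lam : R) x : x != 0 ->
  invert m.1 m.2 @[m --> (lam, x)] --> invert lam x.
Proof.
move=> x0; rewrite /invert.
have c1 : m.1 @[m --> (lam, x)] --> lam by exact: cvg_fst.
have c2 : m.2 @[m --> (lam, x)] --> x by exact: cvg_snd.
have c3 : enorm m.2 @[m --> (lam, x)] --> enorm x.
  by apply: (cvg_comp _ _ c2); exact: continuous_enorm.
apply: cvgZ => //; apply: cvgM.
  by apply: (cvg_comp _ (fun y : R => y ^+ 2) c1); exact: exprn_continuous.
apply: cvgV; first by rewrite expf_neq0// gt_eqF// enorm_gt0.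
by apply: (cvg_comp _ (fun y : R => y ^+ 2) c3); exact: exprn_continuous.
Qed.

End Shells.

(** * Moving spheres *)

Section MovingSpheres.
Context {R : realType} {N : nat}.
(** Abstract setting: a positive [v] off the origin, tending to 0 there, with
    P v = kap^2 v - G(x, v). *)
Implicit Types (lam mu L Lam C t r e s y : R) (x z : 'rV[R]_N).
Variables (kap bet : R) (v : 'rV[R]_N -> R) (G : 'rV[R]_N -> R -> R).
Hypothesis kap0 : 0 < kap.
Hypothesis bet0 : 0 < bet.
Hypothesis v_gt0 : forall x, x != 0 -> 0 < v x.
Hypothesis v_cont : forall x, x != 0 -> {for x, continuous v}.
Hypothesis v_small : forall e, 0 < e ->
  exists2 r, 0 < r & forall x, x != 0 -> enorm x < r -> v x < e.
Hypothesis v_eqn : forall x, x != 0 ->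
  polar_quot v x s @[s --> 0^'] --> kap ^+ 2 * v x - G x (v x).
Hypothesis G_incr : forall x y s, x != 0 -> 0 < y -> 1 < s ->
  G x y < G (s *: x) y.

(** Only decrements from the value [v x] matter, since the comparison is made
    where the inverted copy of [v] lies below [v]. *)
Definition lipschitz_at L x := forall y, 0 <= y <= v x ->
  G x (v x) - G x y <= L * enorm x `^ bet * (v x - y).

Hypothesis G_lip : forall Lam, exists2 L, 0 <= L & forall x, x != 0 ->
  enorm x <= Lam -> lipschitz_at L x.

Definition gap (lam : R) x := v (invert lam x) - v x.

(** A parabola in ln |x|, for which second differences are exact; [C = 0] gives
    the constant comparison function 1. *)
Definition bump C (t0 : R) (x : 'rV[R]_N) := 1 - C * (ln (enorm x) - t0) ^+ 2.

Lemma polar_sdiff_bump (C t0 m : R) x s : x != 0 ->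
  polar_sdiff (fun z => m * bump C t0 z) x s = - (2 * C * m) * s ^+ 2.
Proof.
move=> x0.
rewrite (polar_sdiff_radial (fun t => m * (1 - C * (t - t0) ^+ 2)))// /sdiff.
by ring.
Qed.

(** At a touching point of the gap with a nonpositive multiple of the bump,
    P(gap) = kap^2 gap - G(x', v x') + G(x, v x) with x' the inverse of x. As x'
    lies further out on the same ray, G(x', .) exceeds G(x, .) strictly, and the
    Lipschitz bound controls the rest. With [m = 0] the strictness rules out
    interior zeros of a nonnegative gap. *)
Lemma gap_touching L lam x (m : R) C (t0 r1 r2 : R) :
  0 < lam -> 0 <= r1 -> r1 < enorm x < r2 -> enorm x < lam -> x != 0 ->
  lipschitz_at L x -> 0 <= m -> 0 <= bump C t0 x ->
  gap lam x = - (m * bump C t0 x) ->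
  (forall z, r1 < enorm z < r2 -> - (m * bump C t0 z) <= gap lam z) ->
  m * ((L * enorm x `^ bet - kap ^+ 2) * bump C t0 x) <= 2 * C * m -> False.
Proof.
move=> lam0 r10 r1x xlam x0 Lx m0 b0 gx gz Hle.
have ex : 0 < enorm x by rewrite enorm_gt0.
have ix0 : invert lam x != 0 by exact: invert_neq0.
have Eq s : polar_quot (gap lam) x s =
    polar_quot v (invert lam x) s - polar_quot v x s.
  rewrite /polar_quot -mulrBl; congr (_ / _).
  rewrite -polar_sdiff_invert// /polar_sdiff /gap.
  have -> : sdiff (fun t => v (invert lam (expR t *: x)) - v (expR t *: x)) s =
    sdiff (fun t => (v \o invert lam) (expR t *: x)) s
     - sdiff (fun t => v (expR t *: x)) s by rewrite /sdiff/=; ring.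
  rewrite [in RHS]opprD [RHS]addrACA -mulrBr -sumrB; congr (_ + _ * _).
  apply: eq_bigr => i _; rewrite -sumrB; apply: eq_bigr => j _.
  by rewrite /sdiff/=; ring.
have gl : polar_quot (gap lam) x s @[s --> 0^'] -->
   (kap ^+ 2 * v (invert lam x) - G (invert lam x) (v (invert lam x)))
   - (kap ^+ 2 * v x - G x (v x)).
  have -> : polar_quot (gap lam) x =
    (fun s => polar_quot v (invert lam x) s - polar_quot v x s).
    by apply/funext => s; exact: Eq.
  by apply: cvgB; exact: v_eqn.
have T := @touching R N (gap lam) (fun z => m * bump C t0 z) x r1 r2 _
  (- (2 * C * m)) r10 r1x _ gl _.
have {T} : - - (2 * C * m) <=
   (kap ^+ 2 * v (invert lam x) - G (invert lam x) (v (invert lam x)))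
   - (kap ^+ 2 * v x - G x (v x)).
  apply: T => [z zr|s]; last by rewrite polar_sdiff_bump.
  by rewrite gx addNr -lerBlDr sub0r; exact: gz.
rewrite opprK.
have vi0 : 0 < v (invert lam x) by exact: v_gt0.
have gle : v (invert lam x) <= v x.
  by rewrite -subr_le0 -/(gap lam x) gx oppr_le0 mulr_ge0.
have Gi : G x (v (invert lam x)) < G (invert lam x) (v (invert lam x)).
  apply: G_incr => //; rewrite ltr_pdivlMr ?exprn_gt0// mul1r.
  by rewrite ltr_pXn2r// nnegrE ltW.
have := Lx (v (invert lam x)); rewrite (ltW vi0) gle => /(_ isT).
have -> : v (invert lam x) = v x - m * bump C t0 x.
  by rewrite -gx /gap; ring.
move: Gi; rewrite (_ : v (invert lam x) = v x - m * bump C t0 x); last first.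
  by rewrite -gx /gap; ring.
move: Hle; set b := bump _ _ _; set E := L * _.
move=> Hle Gi Li Ti.
have : m * ((E - kap ^+ 2) * b) = E * (m * b) - kap ^+ 2 * (m * b) by ring.
have : E * (v x - (v x - m * b)) = E * (m * b) by ring.
have : kap ^+ 2 * (v x - m * b) = kap ^+ 2 * v x - kap ^+ 2 * (m * b) by ring.
lra.
Qed.

Lemma gap_sphere lam x : 0 < lam -> enorm x = lam -> gap lam x = 0.
Proof. by move=> l0 xl; rewrite /gap invert_sphere// subrr. Qed.

Lemma gap_continuous2 lam x : 0 < lam -> x != 0 ->
  gap m.1 m.2 @[m --> (lam, x)] --> gap lam x.
Proof.
move=> lam0 x0; apply: cvgB.
  apply: (cvg_comp _ _ (invert_continuous2 lam x x0)).
  by apply: v_cont; exact: invert_neq0.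
apply: (@cvg_comp _ _ _ snd v _ (nbhs x)); first exact: cvg_snd.
exact: v_cont.
Qed.

Lemma gap_continuous lam x : 0 < lam -> x != 0 -> {for x, continuous (gap lam)}.
Proof.
move=> lam0 x0; suff : gap lam z @[z --> x] --> gap lam x by [].
exact: (@continuous2_cvg _ _ _ _ (nbhs x) _ (fun=> lam) id gap lam x
  (gap_continuous2 lam x lam0 x0) (cvg_cst _) cvg_id).
Qed.

Lemma gap_continuousl lam x : 0 < lam -> x != 0 ->
  gap l x @[l --> lam] --> gap lam x.
Proof.
move=> lam0 x0.
exact: (@continuous2_cvg _ _ _ _ (nbhs lam) _ id (fun=> x) gap lam x
  (gap_continuous2 lam x lam0 x0) cvg_id (cvg_cst _)).
Qed.

Lemma bump_continuous C (t0 : R) x : x != 0 -> {for x, continuous (bump C t0)}.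
Proof.
rewrite -enorm_gt0 => x0.
have h1 : ln (enorm z) @[z --> x] --> ln (enorm x).
  apply: (@cvg_comp _ _ _ (@enorm R N) (@ln R) _ (nbhs (enorm x))).
    exact: continuous_enorm.
  exact: continuous_ln.
have h2 : ln (enorm z) - t0 @[z --> x] --> ln (enorm x) - t0.
  exact: (cvgB h1 (cvg_cst t0)).
have h3 : (ln (enorm z) - t0) ^+ 2 @[z --> x] --> (ln (enorm x) - t0) ^+ 2.
  exact: (cvgM h2 h2).
have h4 : C * (ln (enorm z) - t0) ^+ 2 @[z --> x] -->
    C * (ln (enorm x) - t0) ^+ 2 by exact: (cvgM (cvg_cst C) h3).
exact: (cvgB (cvg_cst (1 : R)) h4).
Qed.

(** If the conclusion failed, the minimum of gap / bump over the shell would be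
    an interior touching point excluded by [gap_touching]. *)
Lemma gap_shell L lam (m : R) C (t0 r1 r2 : R) :
  0 < r1 -> r2 <= lam -> 0 <= m ->
  (forall x, x != 0 -> enorm x <= lam -> lipschitz_at L x) ->
  (forall x, shell r1 r2 x -> 0 < bump C t0 x /\
     (L * enorm x `^ bet - kap ^+ 2) * bump C t0 x <= 2 * C) ->
  (forall x, enorm x = r1 \/ enorm x = r2 -> - (m * bump C t0 x) <= gap lam x) ->
  forall x, shell r1 r2 x -> - (m * bump C t0 x) <= gap lam x.
Proof.
move=> r10 r2lam m0 Llip b_gt0 bdry x xA; rewrite leNgt; apply/negP => gx.
have lam0 : 0 < lam.
  by case/andP: xA => r1x xr2; rewrite (lt_le_trans r10)// (le_trans r1x)// (le_trans xr2).
have A0 z : shell r1 r2 z -> z != 0 by exact: shell_neq0.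
pose g z := gap lam z / bump C t0 z.
have gcont : {within shell r1 r2, continuous g}.
  apply: continuous_in_subspaceT => z /set_mem zA.
  have bz : bump C t0 z != 0 by rewrite gt_eqF//; case: (b_gt0 z zA).
  have cg := gap_continuous lam z lam0 (A0 z zA).
  exact: (cvgM cg (cvgV bz (bump_continuous C t0 z (A0 z zA)))).
have [y /set_mem yA ymin] :=
  EVT_min_rV (ex_intro _ x xA) (@compact_shell R N r1 r2) gcont.
have by0 : 0 < bump C t0 y by case: (b_gt0 y yA).
pose m' := - g y.
have gyE : gap lam y = - (m' * bump C t0 y).
  by rewrite /m' /g; field; rewrite gt_eqF.
have mm' : m < m'.
  rewrite /m' ltrNr; apply: (le_lt_trans (ymin x (mem_set xA))).
  by rewrite /g ltr_pdivrMr ?mulNr//; case: (b_gt0 x xA).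
have gzle z : r1 <= enorm z <= r2 -> - (m' * bump C t0 z) <= gap lam z.
  move=> zA; have [bz _] := b_gt0 z zA.
  have : g y <= gap lam z / bump C t0 z := ymin z (mem_set zA).
  by rewrite ler_pdivlMr// /m' mulNr opprK.
have nb : enorm y <> r1 /\ enorm y <> r2.
  suff : ~ (enorm y = r1 \/ enorm y = r2).
    by move=> h; split=> e; apply: h; [left|right].
  move=> /bdry; rewrite gyE lerN2 leNgt => /negP; apply.
  by rewrite ltr_pM2r.
have r1y : r1 < enorm y < r2.
  move: yA => /andP[? ?]; case: nb => /eqP n1 /eqP n2.
  by rewrite !lt_neqAle eq_sym n1 n2; apply/andP.
have ylam : enorm y < lam by case/andP: r1y => _ /lt_le_trans; apply.
have y0 := A0 y yA.
apply: (@gap_touching L lam y m' C t0 r1 r2) => //.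
- exact: ltW.
- by apply: Llip => //; exact: ltW.
- by rewrite (le_trans m0)// ltW.
- exact: ltW.
- by move=> z /andP[? ?]; apply: gzle; rewrite !ltW.
- rewrite mulrC -[2 * C * m']mulrC mulrC ler_wpM2l//; last by case: (b_gt0 y yA).
  by rewrite (le_trans m0)// ltW.
Qed.

Definition gap_ge0 lam := forall x, x != 0 -> enorm x <= lam -> 0 <= gap lam x.

(** Where L |x|^bet <= kap^2 the constant 1 is a comparison function. Near the
    origin the gap is at least - v, which is arbitrarily small, so that the
    punctured ball is exhausted by shells up to an error [e]. *)
Lemma gap_inner L lam r :
  0 < r -> r <= lam -> 0 <= L -> L * r `^ bet <= kap ^+ 2 ->
  (forall x, x != 0 -> enorm x <= lam -> lipschitz_at L x) ->
  (forall x, enorm x = r -> 0 <= gap lam x) ->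
  forall x, x != 0 -> enorm x <= r -> 0 <= gap lam x.
Proof.
move=> r0 rlam L0 Lr Llip bdry x x0 xr.
have lam0 := lt_le_trans r0 rlam.
have ex : 0 < enorm x by rewrite enorm_gt0.
apply/ler_addgt0Pl => e e0.
have [r' r'0 vr'] := v_small e e0.
pose r1 := Num.min (r' / 2) (enorm x).
have r10 : 0 < r1 by rewrite lt_min divr_gt0.
have b1 z : bump 0 0 z = 1 by rewrite /bump mul0r subr0.
have H := @gap_shell L lam e 0 0 r1 r r10 rlam (ltW e0) Llip _ _ x.
rewrite -(mulr1 e) -(b1 x) addrC -lerBlDr sub0r; apply: H.
- move=> z /andP[r1z zr]; rewrite b1; split => //.
  rewrite mulr1 mulr0 subr_le0 (le_trans _ Lr)// ler_wpM2l//.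
  by rewrite ge0_ler_powR ?nnegrE ?enorm_ge0 ?(ltW r0) ?(ltW bet0).
- move=> z [zr1|/bdry gz]; last by rewrite b1 mulr1 (le_trans _ gz)// oppr_le0 ltW.
  have z0 : z != 0 by rewrite -enorm_gt0 zr1.
  have vz : v z < e.
    apply: vr' => //; rewrite zr1 gt_min; apply/orP; left.
    by rewrite ltr_pdivrMr// ltr_pMr// ltr1n.
  rewrite b1 mulr1 /gap lerBrDr.
  have := v_gt0 (invert lam z) (invert_neq0 lam z lam0 z0).
  by move: vz; lra.
- by rewrite /shell/= ge_min lexx orbT.
Qed.

Lemma small_radius L (r0 : R) : 0 <= L -> 0 < r0 ->
  exists2 r, 0 < r <= r0 & L * r `^ bet <= kap ^+ 2.
Proof.
move=> L0 r00.
have L1 : 0 < L + 1 by rewrite ltr_wpDl.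
have k2 : 0 < kap ^+ 2 by rewrite exprn_gt0.
pose q := (kap ^+ 2 / (L + 1)) `^ bet^-1.
have q0 : 0 < q by apply: powR_gt0; exact: divr_gt0.
exists (Num.min q r0); first by rewrite lt_min q0 r00 ge_min lexx orbT.
apply: (@le_trans _ _ (L * q `^ bet)).
  rewrite ler_wpM2l// ge0_ler_powR ?nnegrE ?(ltW bet0)//; last 1 first.
  - by rewrite ge_min lexx.
  - by rewrite le_min !ltW.
  - exact: ltW.
have -> : q `^ bet = kap ^+ 2 / (L + 1).
  by rewrite /q -powRrM mulVf ?gt_eqF// powRr1// ltW// divr_gt0.
by rewrite mulrA ler_pdivrMr// mulrC ler_pM2l// lerDl.
Qed.

Lemma gap_ge0_start : exists2 r, 0 < r & forall lam, 0 < lam -> lam <= r ->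
  gap_ge0 lam.
Proof.
have [L L0 HL] := G_lip 1.
have [r /andP[r0 r1] Lr] := small_radius L 1 L0 ltr01.
exists r => // lam lam0 lamr.
apply: (@gap_inner L lam lam) => //.
- rewrite (le_trans _ Lr)// ler_wpM2l// ge0_ler_powR ?nnegrE ?(ltW bet0)//.
  + exact: ltW.
  + exact: ltW.
- by move=> x x0 xl; apply: HL => //; rewrite (le_trans xl)// (le_trans lamr).
- by move=> x xl; rewrite gap_sphere.
Qed.

Lemma gap_gt0 lam x : 0 < lam -> gap_ge0 lam -> x != 0 -> enorm x < lam ->
  0 < gap lam x.
Proof.
move=> lam0 gl x0 xlam; rewrite lt_def gl ?(ltW xlam)// andbT.
apply/eqP => gx.
have [L L0 HL] := G_lip lam.
apply: (@gap_touching L lam x 0 0 0 0 lam) => //.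
- by rewrite enorm_gt0 x0.
- by apply: HL => //; exact: ltW.
- by rewrite /bump mul0r subr0.
- by rewrite mul0r oppr0.
- by move=> z /andP[z0 zl]; rewrite mul0r oppr0 gl ?(ltW zl)// -enorm_gt0.
- by rewrite mul0r mulr0.
Qed.

(** Three regions for a radius [mu] slightly larger than [lam]: near the origin
    [gap_inner] applies; on the compact shell rho <= |x| <= r1 the gap is positive
    for [lam], hence for [mu]; the remaining shell is so thin that the bump of
    large curvature [C] is still bounded below on it, and [gap_shell] applies. *)
Lemma gap_ge0_extend lam : 0 < lam -> gap_ge0 lam ->
  \forall mu \near lam, lam <= mu -> gap_ge0 mu.
Proof.
move=> lam0 gl.
have lam20 : 0 < 2 * lam by rewrite mulr_gt0.
have [L L0 HL] := G_lip (2 * lam).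
pose C := L * (2 * lam) `^ bet + 1.
have C1 : 1 <= C by rewrite lerDr mulr_ge0// powR_ge0.
have C0 : 0 < C by rewrite (lt_le_trans _ C1).
(* The thickness is chosen so that C (ln |z| - ln lam)^2 <= 1/4 on the thin
   shell. *)
pose dl := (2 * C)^-1.
have dl0 : 0 < dl by rewrite invr_gt0 mulr_gt0.
have Cdl : C * dl ^+ 2 <= 4^-1.
  have -> : C * dl ^+ 2 = 4^-1 * C^-1 by rewrite /dl; field; rewrite gt_eqF.
  by rewrite ler_piMr ?invr_ge0// invf_le1.
pose r1 := lam * expR (- dl).
have r1lam : r1 < lam.
  by rewrite gtr_pMr// -expR0 ltr_expR oppr_lt0.
have r10 : 0 < r1 by rewrite mulr_gt0// expR_gt0.
have [rho /andP[rho0 rhor1] Lrho] := small_radius L r1 L0 r10.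
have nearK : \forall mu \near lam, @shell R N rho r1 `<=` [set x | 0 < gap mu x].
  have cK := (compact_near_coveringP _).1 (@compact_shell R N rho r1).
  apply: (cK R (nbhs lam) (fun mu x => 0 < gap mu x)) => x xK.
  have x0 : x != 0 by exact: shell_neq0 xK.
  have gx : 0 < gap lam x.
    by apply: gap_gt0 => //; case/andP: xK => _ /le_lt_trans; exact.
  have cg : gap m.2 m.1 @[m --> (x, lam)] --> gap lam x.
    exact: (@continuous2_cvg _ _ _ _ (nbhs (x, lam)) _ snd fst gap lam x
      (gap_continuous2 lam x lam0 x0) cvg_snd cvg_fst).
  exact: (cvgr_gt _ cg _ gx).
have near2 : \forall mu \near lam, mu <= 2 * lam.
  by apply: (cvgr_le _ cvg_id); rewrite ltr_pMl// ltr1n.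
have near3 : \forall mu \near lam, mu <= lam * expR dl.
  by apply: (cvgr_le _ cvg_id); rewrite ltr_pMr// expR_gt1.
near=> mu => lammu.
have mu0 : 0 < mu by exact: lt_le_trans lammu.
have mu2 : mu <= 2 * lam by near: mu.
have mudl : mu <= lam * expR dl by near: mu.
have HLmu x : x != 0 -> enorm x <= mu -> lipschitz_at L x.
  by move=> x0 xm; apply: HL => //; exact: le_trans mu2.
have K x : rho <= enorm x <= r1 -> 0 < gap mu x.
  by move=> xK; have := near nearK mu; apply.
move=> x x0 xmu.
have r1mu : r1 <= mu by rewrite (le_trans (ltW r1lam)).
have [xrho|rhox] := leP (enorm x) rho.
  apply: (@gap_inner L mu rho) => //; first exact: le_trans r1mu.
  by move=> z zr; rewrite ltW// K// zr lexx.
have [xr1|r1x] := leP (enorm x) r1; first by rewrite ltW// K// (ltW rhox).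
have := @gap_shell L mu 0 C (ln lam) r1 mu r10 (lexx _) (lexx _) HLmu _ _ x.
rewrite mul0r oppr0; apply; last by rewrite /shell/= (ltW r1x).
- move=> z /andP[r1z zmu].
  have ez : 0 < enorm z by exact: lt_le_trans r1z.
  have h1 : - dl <= ln (enorm z) - ln lam.
    rewrite lerBrDl -[X in _ + X]expRK -lnM ?posrE ?expR_gt0//.
    by rewrite ler_ln// ?posrE.
  have h2 : ln (enorm z) - ln lam <= dl.
    rewrite lerBlDl -[X in _ + X]expRK -lnM ?posrE ?expR_gt0//.
    by rewrite ler_ln ?posrE// ?mulr_gt0 ?expR_gt0// (le_trans zmu).
  have sq : (ln (enorm z) - ln lam) ^+ 2 <= dl ^+ 2.
    by rewrite -[leLHS]real_normK ?num_real// ler_pXn2r ?nnegrE ?(ltW dl0)// ler_norml h1.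
  have sqC : C * (ln (enorm z) - ln lam) ^+ 2 <= 4^-1.
    by rewrite (le_trans _ Cdl)// ler_wpM2l// ltW.
  have sq0 : 0 <= C * (ln (enorm z) - ln lam) ^+ 2.
    by rewrite mulr_ge0 ?sqr_ge0// ltW.
  have b0 : 0 < bump C (ln lam) z.
    by rewrite /bump; lra.
  have b1 : bump C (ln lam) z <= 1 by rewrite /bump; lra.
  split => //.
  have LC : L * enorm z `^ bet - kap ^+ 2 <= C.
    rewrite lerBlDr (@le_trans _ _ C)//; last by rewrite lerDl sqr_ge0.
    rewrite (@le_trans _ _ (L * (2 * lam) `^ bet))// ?lerDl//.
    rewrite ler_wpM2l// ge0_ler_powR ?nnegrE ?enorm_ge0 ?(ltW bet0)//.
    - exact: ltW.
    - exact: le_trans mu2.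
  apply: (@le_trans _ _ (C * bump C (ln lam) z)); first by rewrite ler_wpM2r// ltW.
  by rewrite mulrC ler_wpM2r ?(ltW C0)// (le_trans b1)// ler1n.
- move=> z [zr1|zmu]; rewrite mul0r oppr0; last by rewrite gap_sphere.
  by rewrite ltW// K// zr1 rhor1 lexx.
Unshelve. all: by end_near. Qed.

(** Continuation in [lam]: the supremum of the radii up to which the gap stays
    nonnegative is itself such a radius, and could be exceeded if finite. *)
Lemma gap_ge0_all lam : 0 < lam -> gap_ge0 lam.
Proof.
have [r r0 Hr] := gap_ge0_start.
move=> lam0; apply: contrapT => nlam.
pose S := [set l : R | forall mu, 0 < mu -> mu <= l -> gap_ge0 mu].
have Sr : S r by move=> mu; exact: Hr.
have Slam : ubound S lam.
  move=> l Sl; rewrite leNgt; apply/negP => laml; apply: nlam.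
  by apply: Sl => //; exact: ltW.
have supS : has_sup S by split; [exists r|exists lam].
pose ls := sup S.
have rls : r <= ls by apply: ub_le_sup => //; exists lam.
have ls0 : 0 < ls by exact: lt_le_trans rls.
have below mu : 0 < mu -> mu < ls -> gap_ge0 mu.
  move=> mu0 muls.
  have [|l Sl] := sup_adherent _ supS (eps := ls - mu); first by rewrite subr_gt0.
  by rewrite opprB addrCA subrr addr0 => /ltW mul; exact: Sl.
have gls : gap_ge0 ls.
  move=> x x0; rewrite le_eqVlt => /predU1P[xls|xls].
    by rewrite gap_sphere.
  rewrite leNgt; apply/negP => gx.
  have gc := gap_continuousl ls x ls0 x0.
  have near1 : \forall l \near ls, gap l x < 0 by exact: (cvgr_lt _ gc _ gx).
  have near2 : \forall l \near ls, enorm x < l by exact: lt_nbhsr.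
  near ls^'- => l.
  have : gap l x < 0.
    by near: l; apply: cvg_within; exact: near1.
  have xl : enorm x < l by near: l; apply: cvg_within; exact: near2.
  have lls : l < ls by near: l; exact: nbhs_left_lt.
  have l0 : 0 < l by exact: le_lt_trans (enorm_ge0 x) xl.
  by rewrite ltNge (below l l0 lls x x0 (ltW xl)).
have /nbhs_ballP[e /= e0 He] := gap_ge0_extend ls ls0 gls.
have : ls + e / 2 <= ls.
  apply: ub_le_sup; first by exists lam.
  move=> mu mu0 mule; have [muls|lsmu] := ltP mu ls; first exact: below.
  apply: He => //; rewrite /ball/= ltr_distlC.
  by apply/andP; split; move: mule lsmu e0; lra.
by apply/negP; rewrite -ltNge ltrDl divr_gt0.
Unshelve. all: by end_near. Qed.

(** The sphere of radius sqrt s |x| exchanges [x] and [s *: x]. *)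
Lemma nondecreasing_rays x s : x != 0 -> 1 <= s -> v x <= v (s *: x).
Proof.
move=> x0 s1.
have ex : 0 < enorm x by rewrite enorm_gt0.
have s0 : 0 <= s by rewrite (le_trans _ s1).
pose lam := Num.sqrt s * enorm x.
have ss1 : 1 <= Num.sqrt s by rewrite -sqrtr1 ler_wsqrtr.
have lam0 : 0 < lam by rewrite mulr_gt0// (lt_le_trans _ ss1).
have : 0 <= gap lam x by apply: gap_ge0_all => //; rewrite ler_peMl// ltW.
rewrite /gap subr_ge0; congr (_ <= v _).
rewrite /invert; congr (_ *: _); rewrite /lam exprMn sqr_sqrtr//.
by field; rewrite gt_eqF.
Qed.

End MovingSpheres.

(** * A positive function cannot be too concave on a unit logarithmic shell *)

Lemma enorm_delta {R : realType} {N : nat} (i : 'I_N) :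
  enorm (delta_mx 0 i : 'rV[R]_N) = 1.
Proof.
rewrite /enorm (bigD1 i)//= big1 ?addr0.
  by rewrite mxE !eqxx expr1n sqrtr1.
by move=> j /negbTE ji; rewrite mxE ji andbF expr0n.
Qed.

(** With q = t (1 - t) the quartic q^2 has second derivative
    2 - 12 q >= - 18 q^2, the difference being 2 (3 q - 1)^2, and its fourth
    derivative is positive, so the bound holds for every step [s]. *)
Lemma sdiff_quartic {R : realType} (t s k : R) : 0 <= k ->
  sdiff (fun h => - (k * ((h + t) * (1 - (h + t))) ^+ 2)) s
  <= 18 * (k * (t * (1 - t)) ^+ 2) * s ^+ 2.
Proof.
move=> k0; rewrite -subr_ge0 /sdiff.
have -> : 18 * (k * (t * (1 - t)) ^+ 2) * s ^+ 2 -
  (- (k * ((s + t) * (1 - (s + t))) ^+ 2) - k * ((- s + t) * (1 - (- s + t))) ^+ 2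
   - 2 * - (k * ((0 + t) * (1 - (0 + t))) ^+ 2)) =
  2 * k * s ^+ 2 * ((3 * (t * (1 - t)) - 1) ^+ 2 + s ^+ 2) by ring.
apply: mulr_ge0; last by rewrite addr_ge0 ?sqr_ge0.
by apply: mulr_ge0; rewrite ?sqr_ge0 ?mulr_ge0.
Qed.

(** The largest multiple of the quartic lying below [v] on the shell
    r <= |x| <= e r touches [v] in the interior, because the quartic vanishes at
    both ends. At that point the limit quotient of [v] is at least - 18 [v]. *)
Lemma no_positive_strict_supersolution {R : realType} {N : nat}
    (v l : 'rV[R]_N -> R) (r : R) :
  (0 < N)%N -> 0 < r ->
  (forall x, x != 0 -> 0 < v x) ->
  (forall x, x != 0 -> {for x, continuous v}) ->
  (forall x, x != 0 -> polar_quot v x s @[s --> 0^'] --> l x) ->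
  (forall x, r <= enorm x -> l x < - (18 * v x)) -> False.
Proof.
move=> N0 r0 v_gt0 v_cont v_l l_lt.
pose r2 := r * expR 1.
pose T (z : 'rV[R]_N) := ln (enorm z) - ln r.
pose phi (z : 'rV[R]_N) := (T z * (1 - T z)) ^+ 2.
pose A := @shell R N r r2.
have A0 z : A z -> z != 0 by exact: shell_neq0.
have lnE t : ln (r * expR t) - ln r = t.
  by rewrite lnM ?posrE ?expR_gt0// expRK addrC addKr.
pose xm : 'rV[R]_N := (r * expR 2^-1) *: delta_mx 0 (Ordinal N0).
have exm : enorm xm = r * expR 2^-1.
  by rewrite enormZ_ge0 ?enorm_delta ?mulr1// mulr_ge0 ?expR_ge0// ltW.
have xmA : A xm.
  rewrite /A /shell/= exm /r2; apply/andP; split.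
    by rewrite ler_peMr ?(ltW r0)// -expR0 ler_expR invr_ge0.
  by rewrite ler_pM2l// ler_expR invf_le1 ?ler1n.
pose g (z : 'rV[R]_N) := phi z / v z.
have gcont : {within A, continuous g}.
  apply: continuous_in_subspaceT => z /set_mem zA.
  have z0 := A0 z zA.
  have ez : 0 < enorm z by rewrite enorm_gt0.
  have h1 : ln (enorm y) @[y --> z] --> ln (enorm z).
    apply: (@cvg_comp _ _ _ (@enorm R N) (@ln R) _ (nbhs (enorm z))).
      exact: continuous_enorm.
    exact: continuous_ln.
  have h2 : T y @[y --> z] --> T z by exact: (cvgB h1 (cvg_cst (ln r))).
  have h3 : T y * (1 - T y) @[y --> z] --> T z * (1 - T z).
    exact: (cvgM h2 (cvgB (cvg_cst (1 : R)) h2)).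
  have h4 : phi y @[y --> z] --> phi z by exact: (cvgM h3 h3).
  have vz : v z != 0 by rewrite gt_eqF// v_gt0.
  exact: (cvgM h4 (cvgV vz (v_cont z z0))).
have [y /set_mem yA ymax] :=
  EVT_max_rV (ex_intro _ xm xmA) (@compact_shell R N r r2) gcont.
have y0 := A0 y yA.
have vy := v_gt0 y y0.
have gy : 0 < g y.
  apply: lt_le_trans (ymax xm (mem_set xmA)).
  rewrite divr_gt0 ?v_gt0 ?A0// exprn_gt0// /T exm lnE.
  by rewrite mulr_gt0 ?invr_gt0// subr_gt0 invf_lt1 ?ltr1n.
pose k := (g y)^-1.
have k0 : 0 < k by rewrite invr_gt0.
have kphi : k * phi y = v y.
  have p0 : phi y != 0.
    by apply/eqP => p0; move: gy; rewrite /g p0 mul0r ltxx.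
  by rewrite /k /g; field; rewrite p0 (gt_eqF vy).
have kle z : A z -> k * phi z <= v z.
  move=> zA; have : phi z / v z <= g y := ymax z (mem_set zA).
  rewrite ler_pdivrMr ?v_gt0 ?A0// => h.
  by rewrite /k mulrC ler_pdivrMr// mulrC.
have nb : enorm y <> r /\ enorm y <> r2.
  split=> e; move: gy; rewrite /g /phi /T e.
    by rewrite subrr mul0r expr0n mul0r ltxx.
  by rewrite lnE subrr mulr0 expr0n mul0r ltxx.
have ry : r < enorm y < r2.
  move: yA => /andP[? ?]; case: nb => /eqP n1 /eqP n2.
  by rewrite !lt_neqAle eq_sym n1 n2; apply/andP.
have := @touching R N v (fun z => - (k * phi z)) y r r2 (l y)
  (18 * v y) (ltW r0) ry _ (v_l y y0) _.
have := l_lt y; case/andP: ry => /ltW ry yr2 /(_ ry).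
rewrite ltNge => /negP h1 h2; apply: h1; apply: h2 => [z /andP[rz zr]|s].
  by rewrite kphi subrr subr_ge0 kle// /A /shell/= !ltW.
rewrite (polar_sdiff_radial (fun t => - (k * ((t - ln r) * (1 - (t - ln r))) ^+ 2)))//.
rewrite -kphi /phi.
have -> : (fun t => - (k * ((t + ln (enorm y) - ln r) *
    (1 - (t + ln (enorm y) - ln r))) ^+ 2)) =
    (fun h => - (k * ((h + T y) * (1 - (h + T y))) ^+ 2)).
  by apply/funext => t; rewrite /T addrA.
by apply: sdiff_quartic; exact: ltW.
Qed.

(** * The profile |x|^kap u and its equation *)

Section EmdenFowler.
Context {R : realType} {N : nat}.
Implicit Types (u : 'rV[R]_N -> R) (f : 'rV[R]_N -> R -> R) (x : 'rV[R]_N).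

(** The Emden-Fowler variables: [profile] is v and [reaction] is G. *)
Definition profile (kap : R) u x : R := enorm x `^ kap * u x.

Definition reaction (a kap : R) f x (y : R) : R :=
  enorm x `^ (kap + 2 - a) * f x (enorm x `^ (- kap) * y).

Lemma profileK kap u x : x != 0 -> enorm x `^ (- kap) * profile kap u x = u x.
Proof.
rewrite -enorm_gt0 => x0.
by rewrite /profile mulrA -powRD_gt0// addNr powRr0 mul1r.
Qed.

Lemma profile_gt0 kap u x : (forall z, 0 < u z) -> x != 0 -> 0 < profile kap u x.
Proof. by move=> u0 x0; rewrite mulr_gt0 ?powR_gt0 ?enorm_gt0. Qed.

Lemma profile_continuous kap u x : continuous u -> x != 0 ->
  {for x, continuous (profile kap u)}.
Proof.
rewrite -enorm_gt0 => cu x0.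
have h1 : enorm z `^ kap @[z --> x] --> enorm x `^ kap.
  apply: (@cvg_comp _ _ _ (@enorm R N) (fun y => y `^ kap) _ (nbhs (enorm x))).
    exact: continuous_enorm.
  suff : {for enorm x, continuous (fun y => y `^ kap)} by [].
  apply: differentiable_continuous; apply/derivable1_diffP.
  by apply: derivable_powR; rewrite in_itv/= x0.
exact: (cvgM h1 (cu x)).
Qed.

Lemma bounded_on_ball u (r : R) : continuous u ->
  exists2 M, 0 < M & forall x, enorm x <= r -> u x <= M.
Proof.
move=> cu; have [r0|r0] := ltP r 0.
  exists 1 => // x xr.
  by have := le_lt_trans (le_trans (enorm_ge0 x) xr) r0; rewrite ltxx.
have A0 : @shell R N 0 r 0.
  by rewrite /shell/= -[X in enorm X](scale0r 0) enormZ normr0 mul0r lexx.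
have [y _ ymax] := EVT_max_rV (ex_intro _ _ A0) (@compact_shell R N 0 r)
  (continuous_subspaceT cu).
exists (Num.max 1 (u y)); first by rewrite lt_max ltr01.
move=> x xr; rewrite le_max ymax ?orbT//.
by rewrite inE /shell/= enorm_ge0.
Qed.

Lemma profile_small kap u (e : R) : 0 < kap -> continuous u -> 0 < e ->
  exists2 r, 0 < r & forall x, x != 0 -> enorm x < r -> profile kap u x < e.
Proof.
move=> kap0 cu e0.
have [M M0 uM] := bounded_on_ball u 1 cu.
pose q := (e / M) `^ kap^-1.
have q0 : 0 < q by apply: powR_gt0; exact: divr_gt0.
exists (Num.min 1 q); first by rewrite lt_min ltr01.
move=> x x0; rewrite lt_min => /andP[x1 xq].
have ex : 0 < enorm x by rewrite enorm_gt0.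
have h : enorm x `^ kap < e / M.
  have -> : e / M = q `^ kap.
    by rewrite /q -powRrM mulVf ?gt_eqF// powRr1// ltW// divr_gt0.
  by rewrite gt0_ltr_powR// nnegrE ltW.
apply: (@le_lt_trans _ _ (enorm x `^ kap * M)).
  by rewrite ler_wpM2l ?powR_ge0// uM// ltW.
by rewrite -ltr_pdivlMr.
Qed.

(** Values y between 0 and v x correspond to values of u between 0 and its maximum
    on the ball of radius [Lam], a compact range for the Lipschitz condition. The
    weights combine to |x|^(b0 + 2 - a). *)
Lemma reaction_lipschitz (a kap b0 : R) f u : continuous u ->
  (forall z, 0 < u z) ->
  (forall omega : set R, compact omega -> omega `<=` `[0, +oo[ ->
     exists2 L : R, 0 < L & forall x y z, x != 0 -> omega y -> omega z ->
       `|f x y - f x z| <= L * enorm x `^ b0 * `|y - z|) ->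
  forall Lam, exists2 L, 0 <= L & forall x, x != 0 -> enorm x <= Lam ->
    lipschitz_at (b0 + 2 - a) (profile kap u) (reaction a kap f) L x.
Proof.
move=> cu u0 flip Lam.
have [M M0 uM] := bounded_on_ball u Lam cu.
have [||L L0 HL] := flip `[0, M]%classic; first exact: segment_compact.
  by move=> y /=; rewrite !in_itv/= => /andP[->].
exists L; first exact: ltW.
move=> x x0 xLam y /andP[y0 yv].
have ex : 0 < enorm x by rewrite enorm_gt0.
have Pk : 0 < enorm x `^ (- kap) by exact: powR_gt0.
have PG : 0 < enorm x `^ (kap + 2 - a) by exact: powR_gt0.
set y' := enorm x `^ (- kap) * y.
have y'u : y' <= u x by rewrite -(profileK kap u x x0) ler_wpM2l// ltW.
have y'0 : 0 <= y' by rewrite mulr_ge0// ltW.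
have := HL x (u x) y' x0; rewrite /= !in_itv/= (ltW (u0 x)) uM// y'0.
rewrite (le_trans y'u (uM x xLam)) => /(_ isT isT).
move=> /(le_trans (ler_norm _)).
rewrite (ger0_norm (_ : 0 <= u x - y')) ?subr_ge0//.
move=> h; rewrite /reaction profileK// -mulrBr.
apply: (le_trans (ler_wpM2l (ltW PG) h)).
have -> : u x - y' = enorm x `^ (- kap) * (profile kap u x - y).
  by rewrite mulrBr profileK.
rewrite le_eqVlt; apply/orP; left; apply/eqP.
have -> : enorm x `^ (b0 + 2 - a) =
    enorm x `^ (kap + 2 - a) * enorm x `^ b0 * enorm x `^ (- kap).
  by rewrite -!powRD_gt0//; congr (_ `^ _); ring.
ring.
Qed.

(** The monotonicity hypothesis at the parameters 1 and s^kap: the dilation factor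
    becomes s and the prefactor s^(kap + 2 - a). *)
Lemma reaction_increasing (a : R) f : 0 < N%:R - 2 + a ->
  (forall (x : 'rV[R]_N) (y : R), x != 0 -> 0 < y ->
     {in `[1, +oo[ &, {homo (fun mu : R =>
        mu `^ ((N%:R + 2 - a) / (N%:R - 2 + a)) *
        f (mu `^ (2 / (N%:R - 2 + a)) *: x) (mu^-1 * y))
        : mu nu / mu < nu}}) ->
  let kap := (N%:R - 2 + a) / 2 in
  forall x y s, x != 0 -> 0 < y -> 1 < s ->
  reaction a kap f x y < reaction a kap f (s *: x) y.
Proof.
move=> ha hi kap x y s x0 y0 s1.
have kap0 : 0 < kap by rewrite divr_gt0.
have s0 : 0 < s by exact: lt_trans s1.
have ex : 0 < enorm x by rewrite enorm_gt0.
have PG : 0 < enorm x `^ (kap + 2 - a) by exact: powR_gt0.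
have y'0 : 0 < enorm x `^ (- kap) * y by rewrite mulr_gt0// powR_gt0.
have sk1 : 1 < s `^ kap.
  have <- : (1 : R) `^ kap = 1 by rewrite powR1.
  by rewrite gt0_ltr_powR// nnegrE ltW.
have := hi x (enorm x `^ (- kap) * y) x0 y'0 1 (s `^ kap).
rewrite !in_itv/= lexx (ltW sk1) => /(_ isT isT sk1).
rewrite !powR1 mul1r scale1r invr1 mul1r -!powRrM.
have -> : kap * (2 / (N%:R - 2 + a)) = 1.
  by rewrite /kap; field; rewrite gt_eqF.
have -> : kap * ((N%:R + 2 - a) / (N%:R - 2 + a)) = kap + 2 - a.
  by rewrite /kap; field; rewrite gt_eqF.
rewrite powRr1 ?(ltW s0)// -powRN => h.
rewrite /reaction enormZ_ge0 ?(ltW s0)// !powRM ?(ltW s0)// ?enorm_ge0//.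
rewrite -(ltr_pM2l PG) in h; apply: (lt_le_trans h).
by rewrite mulrCA !mulrA.
Qed.

(** One factor v is kept and the others are bounded below by [c], which turns the
    superlinear reaction into a linear term with a large coefficient. *)
Lemma reaction_ge (a kap b p d c r : R) f u x : 0 <= d -> 0 <= c -> 0 < r ->
  1 < p -> 0 <= 2 - a + b - kap * (p - 1) ->
  (forall z, 0 < u z) -> r <= enorm x -> c <= profile kap u x ->
  d * enorm x `^ b * u x `^ p <= f x (u x) ->
  d * r `^ (2 - a + b - kap * (p - 1)) * c `^ (p - 1) * profile kap u x
  <= reaction a kap f x (profile kap u x).
Proof.
move=> d0 c0 r0 p1 sg0 u0 rx cv hf.
have ex : 0 < enorm x by exact: lt_le_trans rx.
have x0 : x != 0 by rewrite -enorm_gt0.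
have vx : 0 < profile kap u x by exact: profile_gt0.
rewrite /reaction profileK//.
apply: (@le_trans _ _ (enorm x `^ (kap + 2 - a) * (d * enorm x `^ b * u x `^ p)));
  last by rewrite ler_wpM2l ?powR_ge0.
have -> : u x `^ p = enorm x `^ (- kap * p) * (profile kap u x `^ (p - 1) * profile kap u x).
  rewrite -{1}(profileK kap u x x0) powRM ?powR_ge0 ?(ltW vx)// -powRrM.
  congr (_ * _); rewrite -{3}[profile kap u x]powRr1 ?(ltW vx)// -powRD_gt0//.
  by rewrite subrK.
have -> : enorm x `^ (kap + 2 - a) * (d * enorm x `^ b *
   (enorm x `^ (- kap * p) * (profile kap u x `^ (p - 1) * profile kap u x))) =
   d * (enorm x `^ (kap + 2 - a) * enorm x `^ b * enorm x `^ (- kap * p)) *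
   profile kap u x `^ (p - 1) * profile kap u x by ring.
rewrite -!powRD_gt0//.
have -> : kap + 2 - a + b + - kap * p = 2 - a + b - kap * (p - 1) by ring.
rewrite ler_wpM2r ?(ltW vx)//.
apply: ler_pM; rewrite ?mulr_ge0 ?powR_ge0//.
  by rewrite ler_wpM2l// ge0_ler_powR// nnegrE ltW.
by rewrite ge0_ler_powR ?subr_ge0 ?(ltW p1)// nnegrE ltW.
Qed.

End EmdenFowler.

Lemma near_powR_gt {R : realType} (s K : R) : 0 < s -> 0 < K ->
  \forall r \near +oo, K < r `^ s.
Proof.
move=> s0 K0.
near=> r.
have q : K `^ s^-1 < r by near: r; exact: nbhs_pinfty_gt.
have -> : K = (K `^ s^-1) `^ s.
  by rewrite -powRrM mulVf ?gt_eqF// powRr1// ltW.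
by rewrite gt0_ltr_powR// nnegrE ?powR_ge0// (le_trans (powR_ge0 _ _) (ltW q)).
Unshelve. all: by end_near. Qed.

(** The minimum over the unit sphere propagates outward along the rays. *)
Lemma bounded_below_outside {R : realType} {N : nat} (v : 'rV[R]_N -> R) :
  (0 < N)%N -> (forall x, x != 0 -> 0 < v x) ->
  (forall x, x != 0 -> {for x, continuous v}) ->
  (forall x s, x != 0 -> 1 <= s -> v x <= v (s *: x)) ->
  exists2 c, 0 < c & forall x, 1 <= enorm x -> c <= v x.
Proof.
move=> N0 v0 vc vmono.
have A0 : @shell R N 1 1 (delta_mx 0 (Ordinal N0)).
  by rewrite /shell/= enorm_delta lexx.
have cv : {within @shell R N 1 1, continuous v}.
  apply: continuous_in_subspaceT => z /set_mem zA; apply: vc.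
  exact: shell_neq0 zA.
have [y /set_mem yA ymin] :=
  EVT_min_rV (ex_intro _ _ A0) (@compact_shell R N 1 1) cv.
exists (v y); first by apply: v0; exact: shell_neq0 yA.
move=> x x1; have ex : 0 < enorm x by exact: lt_le_trans x1.
pose z := (enorm x)^-1 *: x.
have ez : enorm z = 1 by rewrite enormZ_ge0 ?invr_ge0 ?enorm_ge0// mulVf ?gt_eqF.
have -> : x = enorm x *: z by rewrite scalerA divff ?scale1r// gt_eqF.
apply: (@le_trans _ _ (v z)); first by apply: ymin; rewrite inE /shell/= ez lexx.
by apply: vmono => //; rewrite -enorm_gt0 ez.
Qed.

Theorem theorem3 (R : realType) (N : nat) (a : R) (f : 'rV[R]_N -> R -> R)
  (hN : (3 <= N)%N)
  (ha : 0 < N%:R - 2 + a)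
  (hf : admissible a f)
  (hi : forall (x : 'rV[R]_N) (y : R), x != 0 -> 0 < y ->
     {in `[1, +oo[ &, {homo (fun mu : R =>
        mu `^ ((N%:R + 2 - a) / (N%:R - 2 + a)) *
        f (mu `^ (2 / (N%:R - 2 + a)) *: x) (mu^-1 * y))
        : mu nu / mu < nu}})
  (hii : exists d b p : R,
     [/\ 0 < d, a - 2 < b, 1 < p,
         p < (N%:R + 2 + 2 * b - a) / (N%:R - 2 + a)
       & \forall rho \near +oo, 1 < rho ->
           forall (x : 'rV[R]_N) (y : R), rho <= enorm x -> 0 <= y ->
             d * enorm x `^ b * y `^ p <= f x y]) :
  ~ exists u : 'rV[R]_N -> R, positive_solution a f u.
Proof.
move=> [u usol].
have [u0 uC2 cu _] := usol.
have [_ _ _ [b0 [ab0 _ flip]]] := hf.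
have [d [b [p [d0 _ p1 pS fgrowth]]]] := hii.
have N0 : (0 < N)%N by exact: ltn_trans hN.
pose kap := (N%:R - 2 + a) / 2.
have kap0 : 0 < kap by rewrite divr_gt0.
have bet0 : 0 < b0 + 2 - a by move: ab0; lra.
have v0 x : x != 0 -> 0 < profile kap u x by exact: profile_gt0.
have vc x : x != 0 -> {for x, continuous (profile kap u)}.
  exact: profile_continuous.
have veq x : x != 0 -> polar_quot (profile kap u) x s @[s --> 0^'] -->
    kap ^+ 2 * profile kap u x - reaction a kap f x (profile kap u x).
  move=> x0; rewrite /reaction profileK//.
  exact: (@solution_polar_quot_cvg R N a f u kap x erefl usol x0).
have vmono := @nondecreasing_rays R N kap (b0 + 2 - a) (profile kap u)
  (reaction a kap f) kap0 bet0 v0 vc (fun e => profile_small kap u e kap0 cu) veq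
  (reaction_increasing a f ha hi) (reaction_lipschitz a kap b0 f u cu u0 flip).
have [c c0 vc0] := bounded_below_outside _ N0 v0 vc vmono.
(* Positivity of this exponent is the subcriticality of p. *)
pose sg := 2 - a + b - kap * (p - 1).
have sg0 : 0 < sg.
  move: pS; rewrite ltr_pdivlMr// /sg /kap => pS.
  by lra.
pose K := (kap ^+ 2 + 18) / (d * c `^ (p - 1)).
have dc0 : 0 < d * c `^ (p - 1) by rewrite mulr_gt0// powR_gt0.
have K0 : 0 < K by rewrite divr_gt0// ltr_wpDl ?sqr_ge0.
have nearK := near_powR_gt _ _ sg0 K0.
near (pinfty_nbhs R) => r.
have r1 : 1 < r by near: r; exact: nbhs_pinfty_gt.
have r0 : 0 < r by exact: lt_trans r1.
have rK : K < r `^ sg by near: r.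
have rf : forall (x : 'rV[R]_N) (y : R), r <= enorm x -> 0 <= y ->
  d * enorm x `^ b * y `^ p <= f x y by apply: (near fgrowth r).
apply: (@no_positive_strict_supersolution R N (profile kap u)
  (fun x => kap ^+ 2 * profile kap u x - reaction a kap f x (profile kap u x)) r)
  => // x rx.
have x0 : x != 0 by rewrite -enorm_gt0; exact: lt_le_trans rx.
have cx : c <= profile kap u x by apply: vc0; rewrite (le_trans _ rx)// ltW.
have h := reaction_ge a kap b p d c r f u x (ltW d0) (ltW c0) r0 p1 (ltW sg0)
  u0 rx cx (rf x (u x) rx (ltW (u0 x))).
have : (kap ^+ 2 + 18) * profile kap u x <
    d * r `^ sg * c `^ (p - 1) * profile kap u x.
  rewrite ltr_pM2r ?v0// mulrAC mulrC -ltr_pdivrMr//.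
by move: h; rewrite /sg; lra.
Unshelve. all: by end_near. Qed.
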